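(* Let $n\in\mathbb{N}$ and let $T_1,\dots,T_n\in\mathbb{A}$ be truncated convolution operators, regarded as operators on $L^1[0,1]$. Then for every $f\in L^1[0,1]$, the projective orbit $$\{wT_1^{k_1}\cdots T_n^{k_n}f : k_1,\dots,k_n\in\mathbb{Z}_+,\ w\in\mathbb{K}\}$$ is nowhere dense in $L^1[0,1]$ equipped with the weak topology.
   Context: $\mathbb{K}$ is either $\mathbb{R}$ or $\mathbb{C}$ and all spaces are over $\mathbb{K}$; $\mathbb{Z}_+$ is the set of non-negative integers. $\mathbf{M}$ is the space of finite $\sigma$-additive $\mathbb{K}$-valued Borel measures on $[0,1)$. $C_0[0,1]$ is the Banach space of continuous functions $f:[0,1]\to\mathbb{K}$ with $f(0)=0$, with the sup-norm. For $\mu\in\mathbf{M}$, the operator $C_\mu$ on $C_0[0,1]$ is defined by $C_\mu f(x)=\int f_x(t)\,d\mu(t)$, where $f_x(t)=f(x-t)$ if $t\le x$ and $f_x(t)=0$ if $t>x$ (the restriction to $[0,1]$ of the convolution of $f$ and $\mu$). Since $\|C_\mu f\|_p\le\|\mu\|\,\|f\|_p$, $C_\mu$ extends uniquely to a bounded linear operator on $L^p[0,1]$, $1\le p<\infty$, again denoted $C_\mu$. The operators in $\mathbb{A}=\{C_\mu:\mu\in\mathbf{M}\}$ are called truncated convolution operators; they form a commutative algebra. *)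

(* Defs.v *)
From HB Require Import structures.
From mathcomp Require Import all_boot all_order all_algebra.
From mathcomp Require Import generic_quotient ring_quotient.
From mathcomp Require Import all_classical all_reals all_analysis.
From mathcomp Require Import measurable_realfun.
From mathcomp Require Import complex.

Set Implicit Arguments.
Unset Strict Implicit.
Unset Printing Implicit Defensive.

Import Order.TTheory GRing.Theory Num.Theory.
Import numFieldNormedType.Exports.

Local Open Scope classical_set_scope.
Local Open Scope ring_scope.

Inductive base_field := RealField | ComplexField.

Definition scalar (R : realType) (k : base_field) : numFieldType :=
  match k with RealField => R | ComplexField => R[i] end.

Section Scalar.
Variables (R : realType) (k : base_field).

Definition re : scalar R k -> R :=
  match k as k return scalar R k -> R with
  | RealField => fun z => z
  | ComplexField => fun z => complex.Re z
  end.

Definition im : scalar R k -> R :=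
  match k as k return scalar R k -> R with
  | RealField => fun=> 0
  | ComplexField => fun z => complex.Im z
  end.

(* [a + ib]; over the real field the imaginary part is dropped. *)
Definition mkscalar (a b : R) : scalar R k :=
  match k as k return scalar R k with
  | RealField => a
  | ComplexField => Complex a b
  end.

Implicit Types (z : scalar R k) (a b : R).

Definition modulus z : R := re `|z|.

Lemma reD x y : re (x + y) = re x + re y.
Proof. by rewrite /re; case: k x y => // -[? ?] [? ?]. Qed.

Lemma imD x y : im (x + y) = im x + im y.
Proof. by rewrite /im; case: k x y => [? ?|[? ?] [? ?]] //; rewrite addr0. Qed.

Lemma reM x y : re (x * y) = re x * re y - im x * im y.
Proof.
by rewrite /re /im; case: k x y => [? ?|[? ?] [? ?]] //; rewrite mulr0 subr0.
Qed.

Lemma imM x y : im (x * y) = re x * im y + im x * re y.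
Proof.
by rewrite /re /im; case: k x y => [? ?|[? ?] [? ?]] //; rewrite mulr0 mul0r addr0.
Qed.

Lemma re0 : re 0 = 0. Proof. by rewrite /re; case: k. Qed.
Lemma im0 : im 0 = 0. Proof. by rewrite /im; case: k. Qed.

Lemma modulusE z : modulus z = Num.sqrt (re z ^+ 2 + im z ^+ 2).
Proof.
rewrite /modulus /re /im; case: k z => [z|[a b]] //=.
by rewrite expr0n addr0 sqrtr_sqr.
Qed.

Lemma normE z : `|z| = mkscalar (modulus z) 0.
Proof. by rewrite /modulus /re /mkscalar; case: k z => [z|[a b]]. Qed.

Lemma modulus_ge0 z : 0 <= modulus z.
Proof. by rewrite modulusE sqrtr_ge0. Qed.

Lemma modulus0 : modulus 0 = 0.
Proof. by rewrite /modulus normr0 re0. Qed.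

Lemma modulus0_eq0 z : modulus z = 0 -> z = 0.
Proof.
move=> h; apply: normr0_eq0; rewrite normE h /mkscalar.
by case: (k).
Qed.

Lemma ler_modulusD x y : modulus (x + y) <= modulus x + modulus y.
Proof.
rewrite /modulus -reD; have := ler_normD x y; rewrite /re.
by case: k x y => [x y|x y] //; rewrite lecE => /andP[].
Qed.

Lemma modulusM x y : modulus (x * y) = modulus x * modulus y.
Proof.
rewrite /modulus normrM reM; suff -> : im `|x| = 0 by rewrite mul0r subr0.
by rewrite normE; move: (modulus x) => a; rewrite /im /mkscalar; case: (k).
Qed.

Lemma ler_re z : `|re z| <= modulus z.
Proof.
by rewrite modulusE -sqrtr_sqr ler_wsqrtr// lerDl sqr_ge0.
Qed.

Lemma ler_im z : `|im z| <= modulus z.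
Proof.
by rewrite modulusE -sqrtr_sqr ler_wsqrtr// lerDr sqr_ge0.
Qed.

Lemma modulus_le z : modulus z <= `|re z| + `|im z|.
Proof.
rewrite modulusE -[leRHS]ger0_norm ?addr_ge0// -sqrtr_sqr ler_wsqrtr//.
rewrite sqrrD !real_normK ?num_real//.
by rewrite addrAC lerDl mulrn_wge0// mulr_ge0.
Qed.

Lemma mkscalarD a b c d :
  mkscalar (a + b) (c + d) = mkscalar a c + mkscalar b d.
Proof. by rewrite /mkscalar; case: (k). Qed.

Lemma mkscalarM a b : mkscalar (a * b) 0 = mkscalar a 0 * mkscalar b 0.
Proof.
rewrite /mkscalar; case: (k) => //.
by apply/eqP; rewrite eq_complex /= !mul0r !mulr0 subr0 addr0 !eqxx.
Qed.

Lemma ler_mkscalar a b : (mkscalar a 0 <= mkscalar b 0) = (a <= b).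
Proof. by rewrite /mkscalar; case: (k) => //; rewrite lecE /= eqxx. Qed.

Lemma ltr_mkscalar a b : (mkscalar a 0 < mkscalar b 0) = (a < b).
Proof. by rewrite /mkscalar; case: (k) => //; rewrite ltcE /= eqxx. Qed.

Lemma mkscalar_eq0 a : mkscalar a 0 = 0 -> a = 0.
Proof. by rewrite /mkscalar; case: (k) => // -[]. Qed.

End Scalar.

Section IntegrableFunctions.
Variables (R : realType) (k : base_field).
Local Notation K := (scalar R k).
Local Notation lambda := (@lebesgue_measure R).
Local Notation I01 := (`[0, 1]%classic : set (measurableTypeR R)).

(* Functions are defined on the whole line, but only their values on [0, 1]
   are ever used. *)
Definition integrable01 (f : R -> K) :=
  lambda.-integrable I01 (fun t => (re (f t))%:E) /\
  lambda.-integrable I01 (fun t => (im (f t))%:E).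

Definition ae_eq01 (f g : R -> K) := ae_eq lambda I01 f g.

Definition Lfun01 : {pred R -> K} := mem [set f | integrable01 f].

Lemma Lfun01P f : f \in Lfun01 <-> integrable01 f.
Proof. by rewrite inE. Qed.

Lemma Lfun01_submod_closed : submod_closed Lfun01.
Proof.
split.
  apply/Lfun01P; split.
    rewrite (_ : (fun t => _) = cst 0%E); first exact: integrable0.
    by apply/funext => t; rewrite re0.
  rewrite (_ : (fun t => _) = cst 0%E); first exact: integrable0.
  by apply/funext => t; rewrite im0.
move=> a f g /Lfun01P[rf mf] /Lfun01P[rg mg].
have mI : measurable I01 by exact: measurable_itv.
apply/Lfun01P; split.
- rewrite (_ : (fun t => _) = (fun t => (((re a)%:E * (re (f t))%:E -
    (im a)%:E * (im (f t))%:E) + (re (g t))%:E)%E)).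
    apply: integrableD => //; apply: integrableB => //; exact: integrableZl.
  by apply/funext => t; rewrite -!EFinM -EFinB -EFinD reD reM.
- rewrite (_ : (fun t => _) = (fun t => (((re a)%:E * (im (f t))%:E +
    (im a)%:E * (re (f t))%:E) + (im (g t))%:E)%E)).
    apply: integrableD => //; apply: integrableD => //; exact: integrableZl.
  by apply/funext => t; rewrite -!EFinM -!EFinD imD imM.
Qed.

HB.instance Definition _ := GRing.isSubmodClosed.Build K (R -> K) Lfun01
  Lfun01_submod_closed.

Record L1fun := MkL1fun { L1fun_val :> R -> K ; L1fun_subproof : L1fun_val \in Lfun01 }.

HB.instance Definition _ := [isSub for L1fun_val].
HB.instance Definition _ := [Choice of L1fun by <:].
HB.instance Definition _ := [SubChoice_isSubLmodule of L1fun by <:].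

Definition L1null : {pred L1fun} := mem [set f : L1fun | ae_eq01 f (fun=> 0)].

Lemma L1nullP (f : L1fun) : f \in L1null <-> ae_eq01 f (fun=> 0).
Proof. by rewrite inE. Qed.

Lemma L1null_submod_closed : submod_closed L1null.
Proof.
split; first by apply/L1nullP; exact: ae_eq_refl.
move=> a f g /L1nullP f0 /L1nullP g0; apply/L1nullP.
move: f0 g0; apply: filterS2 => t f0 g0 t01 /=.
change (a * f t + g t = 0); by rewrite f0// g0// mulr0 addr0.
Qed.

HB.instance Definition _ := GRing.isSubmodClosed.Build K L1fun L1null
  L1null_submod_closed.

Lemma integrable_modulus (f : R -> K) : integrable01 f ->
  lambda.-integrable I01 (EFin \o (fun t => modulus (f t))).
Proof.
have mI : measurable I01 by exact: measurable_itv.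
move=> [rf mf]; have srf := integrable_abse rf; have smf := integrable_abse mf.
apply: (le_integrable mI _ _ (integrableD mI srf smf)).
  apply/measurable_EFinP.
  rewrite (_ : (fun t => _) =
    Num.sqrt \o (fun t => re (f t) ^+ 2 + im (f t) ^+ 2)); last first.
    by apply/funext => t; rewrite modulusE.
  apply: measurableT_comp.
    by apply: continuous_measurable_fun; exact: sqrt_continuous.
  move/measurable_int/measurable_EFinP : rf => rf.
  move/measurable_int/measurable_EFinP : mf => mf.
  by apply: measurable_funD; exact: measurable_funX.
move=> t _ /=; rewrite lee_fin ger0_norm ?modulus_ge0//.
by rewrite (le_trans (modulus_le _))// ler_norm.
Qed.

Definition L1fun_norm (f : L1fun) : R :=
  \int[lambda]_(t in I01) modulus (f t).

Lemma L1fun_integrable (f : L1fun) : integrable01 f.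
Proof. by apply/Lfun01P; exact: valP. Qed.

Lemma L1fun_normD (f g : L1fun) :
  L1fun_norm (f + g) <= L1fun_norm f + L1fun_norm g.
Proof.
have mI : measurable I01 by exact: measurable_itv.
have h (u : L1fun) := integrable_modulus (L1fun_integrable u).
rewrite /L1fun_norm -RintegralD//; apply: le_Rintegral => //.
  exact: (integrableD mI (h f) (h g)).
by move=> t _; exact: ler_modulusD.
Qed.

Lemma L1fun_normZ a (f : L1fun) :
  L1fun_norm (a *: f) = modulus a * L1fun_norm f.
Proof.
have mI : measurable I01 by exact: measurable_itv.
have h (u : L1fun) := integrable_modulus (L1fun_integrable u).
rewrite /L1fun_norm -RintegralZl//.
by apply: eq_Rintegral => t _; exact: modulusM.
Qed.

Lemma L1fun_norm_eq0 (f : L1fun) : L1fun_norm f = 0 <-> f \in L1null.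
Proof.
have mI : measurable I01 by exact: measurable_itv.
have h := integrable_modulus (L1fun_integrable f).
have mm := measurable_int _ h.
have E : (\int[lambda]_(t in I01) `|(EFin \o (fun t => modulus (f t))) t|)%E =
    (L1fun_norm f)%:E.
  rewrite /L1fun_norm /Rintegral fineK; last exact: integrable_fin_num.
  by apply: eq_integral => t _ /=; rewrite ger0_norm ?modulus_ge0.
have := ae_eq_integral_abs lambda mI mm; rewrite E => -[h1 h2].
split.
- move=> f0; apply/L1nullP; have : ae_eq lambda I01
      (EFin \o (fun t => modulus (f t))) (cst 0%E) by apply: h1; rewrite f0.
  by apply: filterS => t /[apply] -[] /modulus0_eq0.
- move=> /L1nullP f0; suff /h2[] : ae_eq lambda I01
      (EFin \o (fun t => modulus (f t))) (cst 0%E) by [].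
  by move: f0; apply: filterS => t /[apply] /= ->; rewrite modulus0.
Qed.

Local Open Scope quotient_scope.

Definition L1 : Type := Quotient.quot L1null.
HB.instance Definition _ := GRing.Zmodule.on L1.

Definition L1class (f : L1fun) : L1 := \pi_(Quotient.quot L1null) f.
Definition L1repr (u : L1) : L1fun := repr (u : Quotient.quot L1null).

Lemma L1reprK (u : L1) : L1class (L1repr u) = u. Proof. exact: reprK. Qed.

Lemma L1classP (f g : L1fun) : L1class f = L1class g <-> f - g \in L1null.
Proof.
by split=> [/eqP|h]; [|apply/eqP]; rewrite -Quotient.idealrBE.
Qed.

Lemma L1repr_class (f : L1fun) : L1repr (L1class f) - f \in L1null.
Proof. by apply/L1classP; rewrite L1reprK. Qed.

Lemma L1classD : {morph L1class : f g / f + g}.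
Proof. by move=> f g; rewrite /L1class piE. Qed.

Lemma L1fun_norm_null (f g : L1fun) : f - g \in L1null ->
  L1fun_norm f = L1fun_norm g.
Proof.
move=> fg; have gf : g - f \in L1null by rewrite -opprB rpredN.
apply/eqP; rewrite eq_le; apply/andP; split.
- rewrite -[f in leLHS](subrK g) (le_trans (L1fun_normD _ _))//.
  by move/L1fun_norm_eq0 : fg => ->; rewrite add0r.
- rewrite -[g in leLHS](subrK f) (le_trans (L1fun_normD _ _))//.
  by move/L1fun_norm_eq0 : gf => ->; rewrite add0r.
Qed.

Definition L1scale (a : K) (u : L1) : L1 := L1class (a *: L1repr u).

Lemma L1scale_class a f : L1scale a (L1class f) = L1class (a *: f).
Proof.
by apply/L1classP; rewrite -scalerBr rpredZ// L1repr_class.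
Qed.

Let L1scaleA a b u : L1scale a (L1scale b u) = L1scale (a * b) u.
Proof. by rewrite -[u]L1reprK !L1scale_class scalerA. Qed.

Let L1scale1 : left_id 1 L1scale.
Proof. by move=> u; rewrite -[u]L1reprK L1scale_class scale1r. Qed.

Let L1scaleDr : right_distributive L1scale +%R.
Proof.
move=> a u v; rewrite -[u]L1reprK -[v]L1reprK -L1classD !L1scale_class.
by rewrite scalerDr L1classD.
Qed.

Let L1scaleDl u : {morph L1scale^~ u : a b / a + b}.
Proof.
by move=> a b; rewrite -[u]L1reprK !L1scale_class scalerDl L1classD.
Qed.

HB.instance Definition _ := GRing.Zmodule_isLmodule.Build K L1
  L1scaleA L1scale1 L1scaleDr L1scaleDl.

Definition L1norm (u : L1) : K := mkscalar k (L1fun_norm (L1repr u)) 0.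

Lemma L1norm_class f : L1norm (L1class f) = mkscalar k (L1fun_norm f) 0.
Proof. by congr mkscalar; apply: L1fun_norm_null; exact: L1repr_class. Qed.

Let L1normD u v : L1norm (u + v) <= L1norm u + L1norm v.
Proof.
rewrite -[u]L1reprK -[v]L1reprK -L1classD !L1norm_class -mkscalarD addr0.
by rewrite ler_mkscalar L1fun_normD.
Qed.

Let L1normZ a u : L1norm (a *: u) = `|a| * L1norm u.
Proof.
rewrite -[u]L1reprK [a *: _]L1scale_class !L1norm_class L1fun_normZ normE.
by rewrite mkscalarM.
Qed.

Let L1norm_eq0 u : L1norm u = 0 -> u = 0.
Proof.
rewrite -[u]L1reprK L1norm_class => /mkscalar_eq0/L1fun_norm_eq0 u0.
have -> : 0 = L1class 0 :> L1 by rewrite /L1class piE.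
by apply/L1classP; rewrite subr0.
Qed.

(* The scalars form a numFieldType, so the norm takes its values in K rather
   than in R; the topology of L1 is the one of this norm. *)
HB.instance Definition _ := Lmodule_isNormed.Build K L1
  L1normD L1normZ L1norm_eq0.

End IntegrableFunctions.

Section Measures.
Variables (R : realType) (k : base_field).
Local Notation K := (scalar R k).
Local Notation TR := (measurableTypeR R).
Local Notation J01 := (`[0, 1[%classic : set TR).

(* A finite sigma-additive K-valued Borel measure on [0, 1).  Only the values
   at Borel subsets of [0, 1) are constrained or used; taking F to be
   constantly empty gives that the empty set has measure 0. *)
Record kmeasure := KMeasure {
  kmeasure_val :> set TR -> K ;
  kmeasure_sigma_additive : forall F : (set TR)^nat,
    (forall i, measurable (F i)) -> (forall i, F i `<=` J01) ->
    trivIset setT F ->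
    (fun n => \sum_(0 <= i < n) kmeasure_val (F i)) @ \oo -->
      kmeasure_val (\bigcup_i F i) }.

Definition re_charge (m : kmeasure) (A : set TR) : \bar R :=
  (re (m (A `&` J01)))%:E.

Definition im_charge (m : kmeasure) (A : set TR) : \bar R :=
  (im (m (A `&` J01)))%:E.

Lemma cvg_part (p : K -> R) (u : K^nat) (l : K) :
  (forall x y, p (x - y) = p x - p y) -> (forall x, `|p x| <= modulus x) ->
  u @ \oo --> l -> (p \o u) @ \oo --> p l.
Proof.
move=> pB pm /cvgrPdist_lt ul; apply/cvgrPdist_lt => e e0.
have e0' : 0 < mkscalar k e 0.
  by move: e0; rewrite /mkscalar; case: (k) => //; rewrite ltcE /= eqxx.
apply: filterS (ul _ e0') => n /=; rewrite normE => h; rewrite -pB.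
by rewrite (le_lt_trans (pm _))// -(ltr_mkscalar k).
Qed.

Lemma kmeasure0 (m : kmeasure) : m set0 = 0.
Proof.
have h : (fun n => \sum_(0 <= i < n) m set0) @ \oo --> m set0.
  have := @kmeasure_sigma_additive m (fun=> set0) (fun=> measurable0)
    (fun i => @sub0set _ _).
  by rewrite bigcup0//; apply; apply/trivIsetP => i j _ _ _; rewrite setI0.
have h1 := h; rewrite -cvg_shiftS in h1.
have e : [sequence \sum_(0 <= i < n.+1) m set0]_n =
    (fun n => \sum_(0 <= i < n) m set0 + m set0).
  by apply/funext => n; rewrite /= big_nat_recr.
rewrite e in h1.
have h2 : (fun n => \sum_(0 <= i < n) m set0 + m set0) @ \oo -->
  m set0 + m set0 by apply: cvgD => //; exact: cvg_cst.
have /eqP : m set0 = m set0 + m set0.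
  by apply: (cvg_unique _ h1 h2); exact: norm_hausdorff.
by rewrite -[X in X == _]addr0 (inj_eq (addrI _)) => /eqP <-.
Qed.

Lemma part_sigma_additive (p : K -> R) (m : kmeasure) :
  (forall x y, p (x - y) = p x - p y) -> (forall x, `|p x| <= modulus x) ->
  semi_sigma_additive (fun A : set TR => (p (m (A `&` J01)))%:E).
Proof.
move=> pB pm F mF tF mUF.
have p0 : p 0 = 0 by rewrite -(subrr 0) pB subrr.
have pD x y : p (x + y) = p x + p y.
  by rewrite -[y in LHS]opprK pB -[- y]sub0r pB p0 sub0r opprK.
have mJ : measurable J01 by exact: measurable_itv.
have := @kmeasure_sigma_additive m (fun i => F i `&` J01)
  (fun i => measurableI _ _ (mF i) mJ) (fun i => @subIsetr _ _ _)
  (@trivIset_setIr _ _ _ _ (fun=> J01) tF).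
rewrite -setI_bigcupl => /(cvg_part pB pm) h.
rewrite (_ : (fun n => _) =
    EFin \o (p \o (fun n => \sum_(0 <= i < n) m (F i `&` J01)))).
  by apply: cvg_EFin => //; exact: nearW.
apply/funext => n /=; rewrite sumEFin; congr EFin.
by rewrite (big_morph p pD p0).
Qed.

Let reB (x y : K) : re (x - y) = re x - re y.
Proof. by apply/eqP; rewrite eq_sym subr_eq -reD subrK. Qed.

Let imB (x y : K) : im (x - y) = im x - im y.
Proof. by apply/eqP; rewrite eq_sym subr_eq -imD subrK. Qed.

Let re_charge0 m : re_charge m set0 = 0%E.
Proof. by rewrite /re_charge set0I kmeasure0 re0. Qed.

Let im_charge0 m : im_charge m set0 = 0%E.
Proof. by rewrite /im_charge set0I kmeasure0 im0. Qed.

HB.instance Definition _ m := isCharge.Build _ TR R (re_charge m)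
  (re_charge0 m) (fun _ _ => isT)
  (@part_sigma_additive _ m reB (@ler_re R k)).

HB.instance Definition _ m := isCharge.Build _ TR R (im_charge m)
  (im_charge0 m) (fun _ _ => isT)
  (@part_sigma_additive _ m imB (@ler_im R k)).

(* Integral against a signed measure: the difference of the integrals against
   the two parts of a Jordan decomposition (which is unique). *)
Definition charge_integral (nu : {charge set TR -> \bar R}) (D : set TR)
    (f : TR -> R) : R :=
  let exP := cid (Hahn_decomposition nu) in
  let nuPN := svalP (cid (svalP exP)) in
  \int[jordan_pos nuPN]_(t in D) f t - \int[jordan_neg nuPN]_(t in D) f t.

Definition kintegral (m : kmeasure) (f : R -> K) : K :=
  let Re f := fun t => re (f t) in
  let Im f := fun t => im (f t) in
  mkscalar k
    (charge_integral (re_charge m) J01 (Re f) -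
     charge_integral (im_charge m) J01 (Im f))
    (charge_integral (im_charge m) J01 (Re f) +
     charge_integral (re_charge m) J01 (Im f)).

End Measures.

Section TruncatedConvolution.
Variables (R : realType) (k : base_field).
Local Notation K := (scalar R k).

Definition C0 : set (R -> K) :=
  [set f : R -> K | {within `[0, 1], continuous f} /\ f 0 = 0].

(* t ranges over [0, 1), the domain of the measure. *)
Definition shifted (f : R -> K) (x t : R) : K := if t <= x then f (x - t) else 0.

Definition conv (m : kmeasure R k) (f : R -> K) (x : R) : K :=
  kintegral m (shifted f x).

(* The class u contains f, up to the irrelevant values of f off [0, 1]. *)
Definition represents (f : R -> K) (u : L1 R k) := ae_eq01 (L1repr u) f.

(* T is the bounded linear extension to L^1[0, 1] of C_m, the latter being
   defined on C_0[0, 1]; boundedness is continuity, see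
   linear_bounded_continuous. *)
Definition extends_conv (m : kmeasure R k) (T : {linear L1 R k -> L1 R k}) :=
  continuous T /\
  forall f u, C0 f -> represents f u -> represents (conv m f) (T u).

Definition truncated_convolutions : set {linear L1 R k -> L1 R k} :=
  [set T | exists m, extends_conv m T].

Definition projective_orbit (n : nat) (T : 'I_n -> {linear L1 R k -> L1 R k})
    (f : L1 R k) : set (L1 R k) :=
  [set g | exists (e : 'I_n -> nat) (w : K),
    g = w *: (\big[(fun S S' => S \o S')/idfun]_(i < n) iter (e i) (T i)) f].

End TruncatedConvolution.

Section WeakTopology.
Variables (K : numFieldType) (E : normedModType K).

Definition dual := {phi : {linear E -> K^o} | continuous phi}.

(* The coarsest topology on E making every phi in the dual continuous. *)
Definition weak : Type :=
  initial_topology ((fun x phi => sval phi x) : E -> {ptws dual -> K^o}).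

HB.instance Definition _ := Topological.on weak.

End WeakTopology.

Definition nowhere_dense (X : topologicalType) (A : set X) :=
  (closure A)° = set0.

(* Main.v *)
(* Multiplication by t, D, is a derivation of the truncated convolution algebra,
   and [D, T] commutes with the shifts whenever T does.  Hence an element
   F = w T_1^{k_1} ... T_n^{k_n} f of the orbit satisfies, with P = T_1 ... T_n,
   the identity  P ((D F) * f - F * (D f)) = sum_i k_i (Q_i * F)  (the
   logarithmic derivative), where Q_i does not depend on F.  So finitely many
   fixed operators A_0, ..., A_m applied to F are linearly dependent, and every
   determinant det (phi_i (A_j F)) vanishes: a polynomial condition on finitely
   many functionals, whose zero set is weakly closed and nowhere dense unless the
   determinant is identically 0.  If P f vanishes on no interval [0, d], testing
   at F = 1 and at F = 1 + (1 shifted by s) gives a nonzero determinant.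
   Otherwise the elements with all k_i > 0 lie in a proper closed subspace, and
   the remaining ones belong to orbits of n - 1 operators. *)

From HB Require Import structures.
Require Import Defs.
From mathcomp Require Import all_boot all_order all_algebra.
From mathcomp Require Import all_classical all_reals all_analysis.
From mathcomp Require Import measurable_realfun complex ring lra.

Set Implicit Arguments.
Unset Strict Implicit.
Unset Printing Implicit Defensive.

Import Order.TTheory GRing.Theory Num.Theory.
Import numFieldNormedType.Exports.

Local Open Scope classical_set_scope.
Local Open Scope ring_scope.

(** * Polynomial functions and thin sets *)

(** The exponents and the scalar w vary along the orbit, so the logarithmic derivative is usable
    only once its coefficients [k_i] are eliminated; this is what the determinants do. The factor P
    clears the denominators of the formal sum of the [k_i T_i' / T_i], since the [T_i] need not be
    invertible. The test at the shifted point succeeds because D is a derivation and not a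
    multiplier: the right-hand side commutes with the shift by s, whereas the left-hand side picks
    up an extra term, s times a shift of P f. Functionals that see a function only on [0, s] ignore
    everything shifted by s, so they force the coefficients already found at F = 1, and only the
    extra term is left. Identities between bounded operators are checked on the shifts of 1, whose
    span is dense. Convolution is replaced by a primitive B of it, and the missing unit by an
    injective operator J with B(u, 1) = J u, so that elements with the same image under J agree. The
    analytic work is to show that J is injective and commutes with every bounded operator commuting
    with the shifts. Measures enter through one fact: operators of the algebra commute with the
    shifts. *)

Section PolynomialFunctions.
Variables (K : numFieldType) (E : normedModType K).

(** Polynomiality is asked only along affine lines, with a degree that may depend on the line; this
    keeps everything inside polynomials in one variable. *)
Definition polyfun (p : E -> K) :=
  continuous (p : weak E -> K^o) /\
  forall F G : E, exists q : {poly K}, forall t, p (F + t *: G) = q.[t].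

Lemma weak_continuous_dual (phi : dual E) :
  continuous (sval phi : weak E -> K^o).
Proof.
pose ev := (fun x psi => sval psi x) : E -> {ptws dual E -> K^o}.
have ce : continuous (ev : weak E -> {ptws dual E -> K^o}).
  exact: initial_continuous.
have cp := @proj_continuous {classic (dual E)} (fun=> K^o) phi.
by move=> x A hA; have := ce x _ (cp (ev x) A hA).
Qed.

(** The norm topology refines the weak one. This lets a weak neighbourhood be cut by an affine line,
    whose parametrization is norm continuous. *)
Lemma continuous_to_weak : continuous (idfun : E -> weak E).
Proof.
apply: continuous_comp_initial => x; apply/cvg_sup => phi.
move=> U [? /= [[W oW <-]]] /= Wx /filterS; apply.
by apply: (svalP phi x); exact: open_nbhs_nbhs.
Qed.

Lemma polyfun_dual (phi : dual E) : polyfun (sval phi).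
Proof.
split; first exact: weak_continuous_dual.
move=> F G; exists ((sval phi G)%:P * 'X + (sval phi F)%:P) => t.
by rewrite linearD linearZ !hornerE addrC mulrC.
Qed.

Lemma polyfun_cst c : polyfun (fun=> c).
Proof.
split; first exact: cst_continuous.
by move=> F G; exists c%:P => t; rewrite hornerC.
Qed.

Lemma polyfunD p q : polyfun p -> polyfun q -> polyfun (fun F => p F + q F).
Proof.
move=> [cp lp] [cq lq]; split.
  by move=> x; apply: (@cvgD _ K^o (weak E) (nbhs (x : weak E)) _ p q); [exact: cp|exact: cq].
move=> F G; have [P hP] := lp F G; have [Q hQ] := lq F G.
by exists (P + Q) => t; rewrite hornerD hP hQ.
Qed.

Lemma polyfunM p q : polyfun p -> polyfun q -> polyfun (fun F => p F * q F).
Proof.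
move=> [cp lp] [cq lq]; split.
  by move=> x; apply: (@cvgM K (weak E) (nbhs (x : weak E)) _ p q); [exact: cp|exact: cq].
move=> F G; have [P hP] := lp F G; have [Q hQ] := lq F G.
by exists (P * Q) => t; rewrite hornerM hP hQ.
Qed.

Lemma polyfun_sum (I : Type) (r : seq I) (P : pred I) (p : I -> E -> K) :
  (forall i, polyfun (p i)) -> polyfun (fun F => \sum_(i <- r | P i) p i F).
Proof.
move=> h; elim: r => [|i r IH].
  under eq_fun do rewrite big_nil; exact: polyfun_cst.
under eq_fun do rewrite big_cons; case: (P i) => //; exact: polyfunD.
Qed.

Lemma polyfun_prod (I : Type) (r : seq I) (P : pred I) (p : I -> E -> K) :
  (forall i, polyfun (p i)) -> polyfun (fun F => \prod_(i <- r | P i) p i F).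
Proof.
move=> h; elim: r => [|i r IH].
  under eq_fun do rewrite big_nil; exact: polyfun_cst.
under eq_fun do rewrite big_cons; case: (P i) => //; exact: polyfunM.
Qed.

Lemma polyfun_det n (p : 'I_n -> 'I_n -> E -> K) :
  (forall i j, polyfun (p i j)) ->
  polyfun (fun F => \det (\matrix_(i, j) p i j F)).
Proof.
move=> h; rewrite /determinant; apply: polyfun_sum => s.
apply: polyfunM; first exact: polyfun_cst.
by under eq_fun do under eq_bigr do rewrite mxE; exact: polyfun_prod.
Qed.

Lemma poly_eq0_near0 (q : {poly K}) (e : K) : 0 < e ->
  (forall t, `|t| < e -> q.[t] = 0) -> q = 0.
Proof.
move=> e0 h; apply/eqP; apply: contraT => q0.
(* The points e/2, e/3, ... are [size q] distinct roots of modulus less than e, one more than the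
   degree of a nonzero [q] allows. *)
pose r := [seq e / i.+2%:R | i <- iota 0 (size q)].
have /max_poly_roots : q != 0 := q0.
move=> /(_ r); rewrite size_map size_iota ltnn; apply.
- apply/allP => x /mapP[i _ ->]; apply/eqP; apply: h.
  rewrite gtr0_norm ?divr_gt0//.
  by rewrite ltr_pdivrMr// ltr_pMr// ltr1n.
- rewrite map_inj_uniq ?iota_uniq// => i j /(mulfI (lt0r_neq0 e0)).
  by move=> /invr_inj/eqP; rewrite eqr_nat => /eqP[].
Qed.

(** The counterpart of being contained in a proper algebraic subset. *)
Definition thin (A : set E) :=
  exists2 p, polyfun p & (exists F, p F != 0) /\ (forall F, A F -> p F = 0).

Lemma thin_sub (A C : set E) : A `<=` C -> thin C -> thin A.
Proof. by move=> AC [p pp [p0 h]]; exists p => //; split=> // F /AC/h. Qed.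

(** On the line joining a point where p is nonzero to a point where q is nonzero, both restrict to
    nonzero polynomials in one variable, hence so does their product. *)
Lemma thin_setU A C : thin A -> thin C -> thin (A `|` C).
Proof.
move=> [p pp [[F1 p1] hA]] [q pq [[F2 q2] hC]].
exists (fun F => p F * q F); first exact: polyfunM.
split; last by move=> F [/hA|/hC] ->; rewrite ?mul0r ?mulr0.
have [P hP] := pp.2 F1 (F2 - F1); have [Q hQ] := pq.2 F1 (F2 - F1).
have P0 : P != 0.
  by apply: contraNneq p1 => P0; have := hP 0; rewrite scale0r addr0 P0 horner0 => ->.
have Q0 : Q != 0.
  apply: contraNneq q2 => Q0; have := hQ 1.
  by rewrite scale1r addrC subrK Q0 horner0 => ->.
apply: contrapT => /forallNP h; have /negP := mulf_neq0 P0 Q0; apply.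
apply/eqP/(@poly_eq0_near0 _ 1) => // t _; rewrite hornerM -hP -hQ.
by apply/eqP/negPn/negP; exact: h.
Qed.

Lemma continuous_line (F G : E) : continuous (fun t : K => F + t *: G).
Proof.
move=> t; apply: (@cvgD _ E _ _ (nbhs_filter t)); first exact: cvg_cst.
by apply: (@cvgZr_tmp _ E _ _ (nbhs_filter t)); exact: cvg_id.
Qed.

(** The zero set of p is weakly closed, so it contains the closure. Around a weak interior point F,
    the restriction of p to the line towards a point G with [p G != 0] would vanish near 0, hence
    everywhere, and in particular at G. *)
Lemma thin_nowhere_dense (A : set E) :
  thin A -> nowhere_dense (A : set (weak E)).
Proof.
move=> [p [cp lp] [[G pG] hA]]; rewrite /nowhere_dense -subset0.
have clA : closure (A : set (weak E)) `<=` [set F | p F = 0].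
  rewrite closureE => F /= /(_ [set F | p F = 0]); apply; split=> //.
  apply: (@closed_comp _ K^o (p : weak E -> K^o) [set 0]).
    by move=> x _; exact: cp.
  exact/accessible_closed_set1/hausdorff_accessible/norm_hausdorff.
move=> F /=; rewrite /interior /= => hF; have {}hF : nbhs (F : weak E) [set F | p F = 0].
  exact: filterS hF.
have [q hq] := lp F (G - F).
have c : continuous (fun t : K => F + t *: (G - F) : weak E).
  by move=> t U /continuous_to_weak; exact: continuous_line.
have := c 0 [set F | p F = 0]; rewrite /= scale0r addr0 => /(_ hF).
move=> /nbhs_ballP[e e0 he].
have q0 : q = 0.
  apply: (@poly_eq0_near0 _ e) => // t te; rewrite -hq; apply: he.
  by rewrite /ball /= sub0r normrN.
by have := hq 1; rewrite scale1r addrC subrK q0 horner0 => /eqP; rewrite (negbTE pG).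
Qed.

End PolynomialFunctions.

(** * Linear dependence detected by determinants of functionals *)

Section SeparatingDeterminants.
Variables (K : fieldType) (V : lmodType K) (Y : Type) (phi : Y -> {linear V -> K^o}).

(* If the rows [(phi_y(u_i))_i] span less than the whole space, a column killed
   by a maximal-rank choice of rows is killed by all of them. *)
Lemma dependent_det n (u : 'I_n -> V) (y0 : Y) :
  (forall v, (forall y, phi y v = 0) -> v = 0) ->
  (forall y : 'I_n -> Y, \det (\matrix_(i, j) phi (y i) (u j)) = 0) ->
  exists2 c : 'I_n -> K, exists i, c i != 0 & \sum_i c i *: u i = 0.
Proof.
move=> sep dets.
pose M m (y : 'I_m -> Y) : 'M[K]_(m, n) := \matrix_(i, j) phi (y i) (u j).
(* With rank n, some n of the rows would form an invertible square matrix, whose determinant is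
   among those assumed to vanish. *)
have rk m (y : 'I_m -> Y) : (\rank (M m y) < n)%N.
  rewrite ltn_neqAle rank_leq_col andbT; apply/negP => /eqP r.
  have f : row_full (M m y) by rewrite /row_full r.
  pose g := fullrankfun f.
  have := fullrowsub_unit f; rewrite unitmxE unitfE.
  suff -> : \det (rowsub (fullrankfun f) (M m y)) = 0 by rewrite eqxx.
  rewrite -[RHS](dets (y \o fullrankfun f)); congr (\det _).
  by apply/matrixP => i j; rewrite !mxE.
have [r [m [y Er]] rmax] : exists2 r, exists m (y : 'I_m -> Y), \rank (M m y) = r
    & forall m (y : 'I_m -> Y), (\rank (M m y) <= r)%N.
  have ex : exists r, `[< exists m (y : 'I_m -> Y), \rank (M m y) = r >].
    by exists (\rank (M 1%N (fun=> y0))); apply/asboolP; exists 1%N, (fun=> y0).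
  have ub r : `[< exists m (y : 'I_m -> Y), \rank (M m y) = r >] -> (r <= n)%N.
    by move=> /asboolP[m [y <-]]; exact: rank_leq_col.
  case: (ex_maxnP ex ub) => r /asboolP h hr; exists r => // m y.
  by apply: hr; apply/asboolP; exists m, y.
have : cokermx (M m y) != 0.
  rewrite -mxrank_eq0 mxrank_coker -lt0n subn_gt0; exact: rk.
move=> /matrix0Pn[i0 [j0 cij]].
pose c := col j0 (cokermx (M m y)).
exists (fun i => c i 0); first by exists i0; rewrite mxE.
apply: sep => z; rewrite linear_sum.
(* Adjoining the row of an arbitrary z cannot raise the maximal rank, so this row is a combination
   of the chosen ones and is orthogonal to [c] as they are. *)
pose y' : 'I_(1 + m) -> Y := fun i => match fintype.split i with inl _ => z | inr k => y k end.
have sub : (M _ y <= M _ y')%MS.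
  apply/row_subP => i; rewrite (_ : row i (M _ y) = row (rshift 1 i) (M _ y')).
    exact: row_sub.
  by apply/rowP => j; rewrite !mxE /y' (unsplitK (inr i : 'I_1 + 'I_m)).
have sub' : (M _ y' <= M _ y)%MS.
  have := mxrank_leqif_sup sub => -[_]; rewrite eqn_leq mxrankS//= Er rmax.
  by move=> <-.
have /submxP[A hA] := submx_trans (row_sub (lshift m (0 : 'I_1)) (M _ y')) sub'.
have : row (lshift m (0 : 'I_1)) (M _ y') *m c = 0.
  by rewrite hA /c colE -mulmxA (mulmxA (M _ y)) mulmx_coker mul0mx mulmx0.
move=> /matrixP/(_ 0 0); rewrite !mxE => E.
rewrite -[RHS]E; apply: eq_bigr => k _; rewrite linearZ /= mulrC !mxE.
by rewrite /y' (unsplitK (inl 0 : 'I_1 + 'I_m)).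
Qed.

End SeparatingDeterminants.

(** * Operators commuting with a semigroup of shifts *)

Section BoundedOperators.
Variables (K : numFieldType) (E : normedModType K).

(** A predicate on plain functions, so that composites, iterates, commutators and sections such as
    [B^~ v] can be used without being packed as linear maps. *)
Definition bounded_op (T : E -> E) :=
  (forall a u v, T (a *: u + v) = a *: T u + T v) /\ continuous T.

Section Theory.
Variable T : E -> E.
Hypothesis bT : bounded_op T.

Lemma bounded_op_linear : exists L : {linear E -> E}, T = L.
Proof.
pose L : {linear E -> E} := HB.pack T (GRing.isLinear.Build K E E *:%R T bT.1).
by exists L.
Qed.

Lemma bopD u v : T (u + v) = T u + T v.
Proof. by have [L ->] := bounded_op_linear; rewrite linearD. Qed.
Lemma bopB u v : T (u - v) = T u - T v.
Proof. by have [L ->] := bounded_op_linear; rewrite linearB. Qed.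
Lemma bopZ a u : T (a *: u) = a *: T u.
Proof. by have [L ->] := bounded_op_linear; rewrite linearZ. Qed.
Lemma bop0 : T 0 = 0.
Proof. by have [L ->] := bounded_op_linear; rewrite linear0. Qed.
Lemma bop_sum I (r : seq I) (P : pred I) (F : I -> E) :
  T (\sum_(i <- r | P i) F i) = \sum_(i <- r | P i) T (F i).
Proof. by have [L ->] := bounded_op_linear; rewrite linear_sum. Qed.

End Theory.

Lemma bounded_op_comp (T U : E -> E) :
  bounded_op T -> bounded_op U -> bounded_op (T \o U).
Proof.
move=> bT bU; split; first by move=> a u v; rewrite /= bU.1 bT.1.
by move=> x; apply: continuous_comp; [exact: bU.2|exact: bT.2].
Qed.

Lemma bounded_opB (T U : E -> E) :
  bounded_op T -> bounded_op U -> bounded_op (fun u => T u - U u).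
Proof.
move=> bT bU; split.
  by move=> a u v; rewrite bU.1 bT.1 scalerBr opprD addrACA.
by move=> x; apply: (@cvgB _ E _ _ (nbhs_filter x)); [exact: bT.2|exact: bU.2].
Qed.

Lemma bounded_op_id : bounded_op id.
Proof. by split => // x; exact: cvg_id. Qed.

(** Makes an operator identity a closed condition, to be verified on a total family only. *)
Lemma bounded_op_eq_closed (T U : E -> E) :
  bounded_op T -> bounded_op U -> closed [set u | T u = U u].
Proof.
move=> bT bU; have bTU := bounded_opB bT bU.
rewrite (_ : [set u | T u = U u] = (fun u => T u - U u) @^-1` [set 0]).
  apply: closed_comp; first by move=> x _; exact: bTU.2.
  exact/accessible_closed_set1/hausdorff_accessible/norm_hausdorff.
by apply/seteqP; split => u /=; [move=> ->; rewrite subrr|move/eqP; rewrite subr_eq0 => /eqP].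
Qed.

Definition dual_comp (psi : dual E) (T : E -> E) (bT : bounded_op T) :
  {psi' : dual E | forall u, sval psi' u = sval psi (T u)}.
Proof.
have lin : linear (sval psi \o T : E -> K^o).
  by move=> a u v; rewrite /= bT.1 linearD linearZ.
pose L : {linear E -> K^o} :=
  HB.pack (sval psi \o T : E -> K^o) (GRing.isLinear.Build K E K^o *:%R _ lin).
have cL : continuous L.
  by move=> x; apply: continuous_comp; [exact: bT.2|exact: (svalP psi)].
by exists (exist _ L cL).
Qed.

End BoundedOperators.

(* The example to keep in mind is E = L^1[0, 1], where [S s] is the truncated
   translation by s, [e0] the constant 1, [D] the multiplication by the variable
   and [B] the convolution product. *)
Section ShiftCommutant.
Variables (R : realFieldType) (K : numFieldType) (E : normedModType K).
Variables (S : R -> E -> E) (e0 : E) (D J : E -> E) (B : E -> E -> E).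
Variables (iota : R -> K) (phi : R -> dual E).

Hypothesis bS : forall s, 0 <= s -> bounded_op (S s).
Hypothesis SS : forall s t u, 0 <= s -> 0 <= t -> S s (S t u) = S t (S s u).
Hypothesis S0 : forall u, S 0 u = u.
Hypothesis Se0_neq0 : forall s, 0 < s < 1 -> S s e0 != 0.
Hypothesis total : forall Z : set E, closed Z ->
  (forall a u v, Z u -> Z v -> Z (a *: u + v)) ->
  (forall s, 0 <= s -> Z (S s e0)) -> forall u, Z u.
Hypothesis bD : bounded_op D.
Hypothesis iota_neq0 : forall s, 0 < s -> iota s != 0.
Hypothesis DS : forall s u, 0 <= s -> D (S s u) = S s (D u) + iota s *: S s u.
Hypothesis JS : forall s u, 0 <= s -> J (S s u) = S s (J u).
Hypothesis bJ : bounded_op J.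
Hypothesis J_inj : forall u, J u = 0 -> u = 0.
Hypothesis bBl : forall v, bounded_op (B^~ v).
Hypothesis bBr : forall u, bounded_op (B u).
Hypothesis Be : forall s u, 0 <= s -> B u (S s e0) = S s (J u).
Hypothesis eB : forall s v, 0 <= s -> B (S s e0) v = S s (J v).
Hypothesis phi_sep :
  forall u, (forall y, 0 <= y < 1 -> sval (phi y) u = 0) -> u = 0.
Hypothesis phiS : forall y s u, 0 <= s -> y <= s -> sval (phi y) (S s u) = 0.

(** The abstract substitute for convolution with a measure. *)
Definition multiplier (T : E -> E) :=
  bounded_op T /\ forall s u, 0 <= s -> T (S s u) = S s (T u).

(** In the model, J is convolution with t^2/2. Commutation with this single operator is enough to
    derive that multipliers commute with each other. *)
Hypothesis TJ : forall T u, multiplier T -> T (J u) = J (T u).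

Lemma eq_on_shifts (T U : E -> E) : bounded_op T -> bounded_op U ->
  (forall s, 0 <= s -> T (S s e0) = U (S s e0)) -> forall u, T u = U u.
Proof.
move=> bT bU h; apply: (total (bounded_op_eq_closed bT bU)) => //= a u v.
by rewrite bT.1 bU.1 => -> ->.
Qed.

(** Both sides are bounded in v, and at [v = S s e0] the product B reduces to J, where the claim is
    [TJ]. *)
Lemma multBl T u v : multiplier T -> B (T u) v = T (B u v).
Proof.
move=> mT; have [bT ST] := mT.
move: v; apply: eq_on_shifts; first exact: bBr.
  exact: (bounded_op_comp bT (bBr u)).
by move=> s s0; rewrite /= !Be// ST// (TJ _ mT).
Qed.

Lemma multBr T u v : multiplier T -> B u (T v) = T (B u v).
Proof.
move=> mT; have [bT ST] := mT.
pose T1 := (fun u => B u (T v)); pose T2 := T \o (B^~ v).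
rewrite -[LHS]/(T1 u) -[RHS]/(T2 u); apply: eq_on_shifts => //.
- exact: bBl.
- exact: (bounded_op_comp bT (bBl v)).
by move=> s s0; rewrite /T1 /T2 /= !eB// ST// (TJ _ mT).
Qed.

Lemma mult_id : multiplier id.
Proof. by split => //; exact: bounded_op_id. Qed.

Lemma mult_comp T U : multiplier T -> multiplier U -> multiplier (T \o U).
Proof.
move=> [bT hT] [bU hU]; split; first exact: bounded_op_comp.
by move=> s u s0; rewrite /= hU// hT.
Qed.

Lemma mult_iter n T : multiplier T -> multiplier (iter n T).
Proof.
by move=> mT; elim: n => [|n IH]; [exact: mult_id|exact: (mult_comp mT IH)].
Qed.

Lemma mult_shift s : 0 <= s -> multiplier (S s).
Proof. by move=> s0; split; [exact: bS|move=> t u t0; exact: SS]. Qed.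

(** After applying the injective J, written as [B^~ e0], one operator can act through the first
    factor of B and the other through the second, in either order. *)
Lemma multC T U u : multiplier T -> multiplier U -> T (U u) = U (T u).
Proof.
move=> mT mU; have [bT _] := mT; have [bU _] := mU.
apply/eqP; rewrite -subr_eq0; apply/eqP/J_inj.
have eJ v : B v e0 = J v by rewrite -[e0]S0 Be// S0.
rewrite -eJ (bopB (bBl e0)) (multBl (T u) _ mU) (multBl u _ mT) (multBl _ _ mT).
by rewrite -(multBr _ _ mT) (multBl u _ mU) (multBr _ _ mT) subrr.
Qed.

(* If T is convolution with mu, this commutator is convolution with t mu. *)
Definition dot (T : E -> E) u := D (T u) - T (D u).

(** The terms [iota s *: T (S s u)] that appear when D passes a shift cancel in the commutator. *)
Lemma mult_dot T : multiplier T -> multiplier (dot T).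
Proof.
move=> [bT ST]; split.
  by apply: bounded_opB; apply: bounded_op_comp.
move=> s u s0; rewrite /dot ST// !DS// (bopD bT) (bopZ bT) !ST//.
by rewrite (bopB (bS s0)) opprD addrACA subrr addr0.
Qed.

(** The power rule: [dot] obeys the Leibniz rule, and T commutes with [dot T] by [multC]. *)
Lemma dot_iter T k : multiplier T ->
  forall u, dot (iter k.+1 T) u = k.+1%:R *: iter k T (dot T u).
Proof.
move=> mT; elim: k => [|k IH] u; first by rewrite scale1r.
have mk := mult_iter k mT; have md := mult_dot mT.
have -> : dot (iter k.+2 T) u = dot T (iter k.+1 T u) + T (dot (iter k.+1 T) u).
  by rewrite /dot (bopB mT.1) addrA subrK.
rewrite IH (bopZ mT.1) -[X in X + _]/(dot T (iter k.+1 T u)).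
rewrite (multC _ md (mult_iter k.+1 mT)) -[T (iter k T _)]/(iter k.+1 T _).
by rewrite [k.+2%:R](natrD _ 1 k.+1) scalerDl scale1r.
Qed.

(** Exponents are introduced one operator at a time and the scalar sits innermost, so that
    statements about the orbit go by induction on the list. *)
Inductive orbit_of : seq (E -> E) -> E -> E -> Prop :=
| orbit_nil f w : orbit_of [::] f (w *: f)
| orbit_cons T Ts f G k : orbit_of Ts f G -> orbit_of (T :: Ts) f (iter k T G).

Fixpoint all_mult (Ts : seq (E -> E)) : Prop :=
  if Ts is T :: Ts' then multiplier T /\ all_mult Ts' else True.

Definition comps (Ts : seq (E -> E)) := foldr (fun T U => T \o U) id Ts.

Lemma mult_comps Ts : all_mult Ts -> multiplier (comps Ts).
Proof.
by elim: Ts => [_|T Ts IH /= [mT /IH]]; [exact: mult_id|exact: mult_comp].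
Qed.

Lemma orbit_mult Ts f F U : all_mult Ts -> multiplier U ->
  orbit_of Ts f F -> orbit_of Ts (U f) (U F).
Proof.
move=> + mU; elim: Ts f F => [|T Ts IH] f F.
  by move=> _ h; inversion h; subst; rewrite (bopZ mU.1); constructor.
move=> /= [mT mTs] h; inversion h; subst.
by rewrite multC//; [constructor; exact: IH|exact: mult_iter].
Qed.

(** The i-th entry is the product of all the operators applied to f, with the i-th factor T replaced
    by [dot T]: the terms of the product rule. *)
Fixpoint log_coefs (Ts : seq (E -> E)) (f : E) : seq E :=
  if Ts is T :: Ts' then
    dot T (comps Ts' f) :: [seq T Q | Q <- log_coefs Ts' f]
  else [::].

Lemma Bsym u v : B u v = B v u.
Proof.
move: v; apply: (eq_on_shifts (bBr u) (bBl u)).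
by move=> s s0; rewrite Be ?eB.
Qed.

(** The outer T replaces a division by T: the power rule leaves one factor fewer than [iter k T],
    and T restores it. For k = 0 both sides vanish. *)
Lemma dot_iter_mul T k f G : multiplier T ->
  T (B (dot (iter k T) G) f) = k%:R *: B (dot T f) (iter k T G).
Proof.
move=> mT; case: k => [|k].
  by rewrite /dot subrr scale0r -multBl// (bop0 mT.1) (bop0 (bBl f)).
have mk := mult_iter k mT; have mk1 := mult_iter k.+1 mT; have md := mult_dot mT.
rewrite dot_iter// (bopZ (bBl f)) (bopZ mT.1); congr (_ *: _).
by rewrite (multBl _ _ mk) (multBl _ _ md) (multBr _ _ mk1) (multBl _ _ md) Bsym.
Qed.

(** The coefficients are the exponents. For F = w f the left-hand side is zero by symmetry of B;
    applying [iter k T] adds, by the Leibniz rule, one term, with coefficient k. *)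
Lemma log_derivative Ts f F : all_mult Ts -> orbit_of Ts f F ->
  exists c : nat -> K, comps Ts (B (D F) f - B F (D f)) =
    \sum_(i < size (log_coefs Ts f)) c i *: B (nth 0 (log_coefs Ts f) i) F.
Proof.
elim: Ts F => [|T Ts IH] F.
  move=> _ h; inversion h; subst; exists (fun=> 0); rewrite big_ord0 /=.
  by rewrite (bopZ bD) (bopZ (bBl f)) (bopZ (bBl _)) -scalerBr Bsym subrr scaler0.
move=> /= [mT mTs] h; inversion h; subst.
have [c Ec] := IH _ mTs H3.
have mk := mult_iter k mT; have mP := mult_comps mTs.
exists (fun i => if i is j.+1 then c j else k%:R).
rewrite size_map big_ord_recl /=.
have -> : B (D (iter k T G)) f - B (iter k T G) (D f) =
    iter k T (B (D G) f - B G (D f)) + B (dot (iter k T) G) f.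
  rewrite (bopB mk.1) -(multBl (D G) _ mk) -(multBl G _ mk) addrAC.
  by rewrite -(bopD (bBl f)) /dot subrKC.
rewrite (bopD mP.1) (bopD mT.1) addrC; congr (_ + _).
  rewrite (multC _ mT mP) dot_iter_mul// (bopZ mP.1); congr (_ *: _).
  by rewrite -(multBl _ _ mP) (multC _ mP (mult_dot mT)).
rewrite (multC _ mP mk) Ec (bop_sum mk.1) (bop_sum mT.1).
apply: eq_bigr => i _; rewrite (bopZ mk.1) (bopZ mT.1).
by rewrite add0n (nth_map 0)// (multBl _ _ mT) (multBr _ _ mk).
Qed.

(* The determinant is nonzero either at [e0] or at [e0 + S s e0], for s close
   to 1, because of the term [iota s *: S s (J g)] in [A0 (S s e0)]. *)
Lemma thin_log_derivative_free m (Q : 'I_m -> E) g h :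
  (forall s, 0 < s < 1 -> S s g != 0) ->
  (forall c : 'I_m -> K, \sum_i c i *: Q i = 0 -> forall i, c i = 0) ->
  thin [set F | exists c : 'I_m -> K,
    B (D F) g - B F h = \sum_i c i *: B (Q i) F].
Proof.
move=> gS free.
pose Y := {y : R | 0 <= y < 1}.
pose A0 F := B (D F) g - B F h.
pose A (i : 'I_m.+1) : E -> E :=
  if unlift ord0 i is Some j then B (Q j) else A0.
have bA0 : bounded_op A0.
  by apply: bounded_opB => //; exact: (bounded_op_comp (bBl g) bD).
have bA i : bounded_op (A i) by rewrite /A; case: unlift.
have AS j : A (lift ord0 j) = B (Q j) by rewrite /A liftK.
have A0E : A ord0 = A0 by rewrite /A unlift_none.
have pf (y : 'I_m.+1 -> Y) : polyfun (fun F =>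
    \det (\matrix_(i, j) sval (phi (sval (y i))) (A j F))).
  apply: (polyfun_det (p := fun i j F => sval (phi (sval (y i))) (A j F))) => i j.
  have [psi Epsi] := dual_comp (phi (sval (y i))) (bA j).
  by under eq_fun do rewrite -Epsi; exact: polyfun_dual.
have [[y [F detF]]|] := pselect (exists y F,
    \det (\matrix_(i, j) sval (phi (sval (y i : Y))) (A j F)) != 0).
  eexists; first exact: (pf y).
  split; first by exists F.
  move=> G [c EG].
  (* The relation satisfied by G says that the vector (1, -c) is in the kernel of the matrix, and
     its first entry makes it nonzero. *)
  pose cc : 'cV[K]_m.+1 := \col_i (if unlift ord0 i is Some j then - c j else 1).
  apply/eqP; rewrite -det_tr; apply/det0P; exists cc^T.
    by apply/eqP => /matrixP/(_ 0 ord0); rewrite !mxE unlift_none => /eqP; rewrite oner_eq0.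
  apply/rowP => i; rewrite !mxE.
  rewrite (eq_bigr (fun j => sval (phi (sval (y i)))
    ((if unlift ord0 j is Some j then - c j else 1) *: A j G))); last first.
    by move=> j _; rewrite !mxE linearZ.
  rewrite -linear_sum big_ord_recl A0E unlift_none scale1r {1}/A0 EG.
  rewrite [X in _ + X](eq_bigr (fun j => - (c j *: B (Q j) G))); last first.
    by move=> j _; rewrite AS liftK scaleNr.
  by rewrite sumrN subrr linear0.
(* All determinants now vanish identically, so the vectors [A j F] are dependent for every F. *)
move=> ndet; exfalso.
have y0 : Y by exists 0; rewrite lexx ltr01.
pose phiY (y : Y) := sval (phi (sval y)).
have sep v : (forall y, phiY y v = 0) -> v = 0.
  by move=> hv; apply: phi_sep => y hy; exact: (hv (exist _ y hy)).
have dep F : exists2 c : 'I_m.+1 -> K, exists i, c i != 0 &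
    c ord0 *: A0 F + \sum_j c (lift ord0 j) *: B (Q j) F = 0.
  have [|c cn0] := @dependent_det _ _ _ phiY _ (A^~ F) y0 sep.
    move=> y; apply: contrapT => /eqP dn0; apply: ndet; exists y, F.
    exact: dn0.
  rewrite big_ord_recl A0E => Ec; exists c => //.
  by rewrite -[RHS]Ec; congr (_ + _); apply: eq_bigr => j _; rewrite AS.
have Be0 v : B v e0 = J v by rewrite -[e0]S0 Be// S0.
have freeJ (c : 'I_m -> K) : \sum_j c j *: J (Q j) = 0 -> forall j, c j = 0.
  move=> h0; apply: free; apply: J_inj; rewrite (bop_sum bJ) -[RHS]h0.
  by apply: eq_bigr => j _; rewrite (bopZ bJ).
have nonzero (c : 'I_m.+1 -> K) :
    (exists i, c i != 0) -> c ord0 = 0 -> (forall j, c (lift ord0 j) = 0) -> False.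
  by move=> [i /eqP ci] c0 cS; case: (unliftP ord0 i) ci => [j|] ->.
(* At [e0] the vectors [B (Q j) e0 = J (Q j)] are free, so the dependence must involve [A0 e0],
   which can be solved for. *)
have [b Eb] : exists b : 'I_m -> K, A0 e0 = \sum_j b j *: J (Q j).
  have [c cn0 Ec] := dep e0.
  have c0 : c ord0 != 0.
    apply/eqP => c0; apply: (nonzero c cn0 c0) => j.
    apply: (freeJ (fun j => c (lift ord0 j))); rewrite -[RHS]Ec c0 scale0r add0r.
    by apply: eq_bigr => i _; rewrite Be0.
  exists (fun j => - (c ord0)^-1 * c (lift ord0 j)).
  move/eqP: Ec; rewrite addr_eq0 => /eqP/(congr1 (fun u => (c ord0)^-1 *: u)).
  rewrite scalerA mulVf// scale1r => ->; rewrite scalerN scaler_sumr -sumrN.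
  by apply: eq_bigr => j _; rewrite Be0 scalerA mulNr scaleNr.
have [y ydet] : exists y : 'I_m -> Y, \det (\matrix_(i, j) phiY (y i) (J (Q j))) != 0.
  apply: contrapT => /forallNP hy.
  have [|c [i ci] Ec] := @dependent_det _ _ _ phiY _ (fun j => J (Q j)) y0 sep.
    by move=> y; apply/eqP/negPn/negP; exact: hy.
  by move/eqP: ci; apply; exact: (freeJ c Ec).
have [s s01 ys] : exists2 s, 0 < s < 1 & forall j, sval (y j) <= s.
  (* The default 1/2 keeps s positive when there are no points or all of them are 0. *)
  pose s := \big[Order.max/2^-1]_j sval (y j).
  exists s; last by move=> j; exact: le_bigmax.
  apply/andP; split; first by apply: lt_le_trans (bigmax_ge_id _ _ _ _).
  apply: bigmax_lt => [|j _]; first by rewrite invf_lt1// ltr1n.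
  by case/andP: (svalP (y j)).
have [s_gt0 _] := andP s01; have s0 := ltW s_gt0.
have mS := mult_shift s0; have bSs := bS s0.
have AS0 : A0 (S s e0) = S s (A0 e0) + iota s *: S s (J g).
  rewrite /A0 DS// (bopD (bBl g)) (bopZ (bBl g)) (multBl _ _ mS) !eB//.
  by rewrite (bopB bSs) (Bsym e0 h) Be0 addrAC.
have [c cn0] := dep (e0 + S s e0).
rewrite (bopD bA0) AS0 Eb => Ec.
have {}Ec : \sum_j (c ord0 * b j + c (lift ord0 j)) *: (J (Q j) + S s (J (Q j))) +
    c ord0 *: (iota s *: S s (J g)) = 0.
  rewrite -[RHS]Ec addrA 2!scalerDr addrAC; congr (_ + _).
  rewrite -scalerDr (bop_sum bSs) -big_split /= scaler_sumr -big_split /=.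
  apply: eq_bigr => j _; rewrite (bopZ bSs) -scalerDr scalerA.
  by rewrite [in RHS](bopD (bBr (Q j))) Be0 Be// -scalerDl.
(* The functionals at [y i <= s] kill every term in [S s]; on what remains, their matrix at the
   [J (Q j)] is invertible. *)
have cb j : c ord0 * b j + c (lift ord0 j) = 0.
  have : (\row_j (c ord0 * b j + c (lift ord0 j))) *m
      (\matrix_(i, j) phiY (y i) (J (Q j)))^T = 0.
    apply/rowP => i; rewrite !mxE.
    have := congr1 (phiY (y i)) Ec.
    rewrite linear0 linearD !linearZ /= phiS// !scaler0 addr0 linear_sum => h0.
    rewrite -[RHS]h0; apply: eq_bigr => k _; rewrite !mxE linearZ /= linearD /= phiS//.
    by rewrite addr0.
  move=> /(congr1 (mulmx^~ (invmx (\matrix_(i, j) phiY (y i) (J (Q j)))^T))).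
  rewrite mulmxK ?mul0mx; first by move=> /rowP/(_ j); rewrite !mxE.
  by rewrite unitmxE det_tr unitfE.
move: Ec; rewrite big1; last by move=> j _; rewrite cb scale0r.
rewrite add0r => /eqP; rewrite !scaler_eq0 (negbTE (iota_neq0 s_gt0)) /=.
case/orP => [/eqP c0|].
  apply: (nonzero c cn0 c0) => j; by have := cb j; rewrite c0 mul0r add0r.
rewrite -JS// => /eqP/J_inj/eqP; exact/negP/gS.
Qed.

Lemma thin_log_derivative m (Q : 'I_m -> E) g h :
  (forall s, 0 < s < 1 -> S s g != 0) ->
  thin [set F | exists c : 'I_m -> K,
    B (D F) g - B F h = \sum_i c i *: B (Q i) F].
Proof.
move=> gS; elim: m Q => [|m IH] Q.
  by apply: thin_log_derivative_free => // c _ [].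
have [free|] := pselect (forall c : 'I_m.+1 -> K,
    \sum_i c i *: Q i = 0 -> forall i, c i = 0).
  exact: thin_log_derivative_free.
move=> /existsNP[c] /not_implyP[Ec] /existsNP[j] /eqP cj.
apply: thin_sub (IH (fun i => Q (lift j i))) => F [d Ed].
exists (fun i => d (lift j i) - d j * (c j)^-1 * c (lift j i)).
have EB : \sum_i c i *: B (Q i) F = 0.
  rewrite -[RHS](bop0 (bBl F)) -[in RHS]Ec (bop_sum (bBl F)).
  by apply: eq_bigr => i _; rewrite (bopZ (bBl F)).
rewrite Ed (bigD1_ord j) //=.
under [RHS]eq_bigr do rewrite scalerBl -scalerA.
rewrite sumrB -scaler_sumr.
move: EB; rewrite (bigD1_ord j) //= => /eqP; rewrite addrC addr_eq0 => /eqP ->.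
by rewrite scalerN opprK scalerA mulfVK// addrC.
Qed.

Inductive remove1 : seq (E -> E) -> seq (E -> E) -> Prop :=
| remove1_head T Ts : remove1 (T :: Ts) Ts
| remove1_tail T Ts Us : remove1 Ts Us -> remove1 (T :: Ts) (T :: Us).

Lemma remove1_size Ts Us : remove1 Ts Us -> size Ts = (size Us).+1.
Proof. by elim=> // T {}Ts {}Us _ /= ->. Qed.

Lemma remove1_mult Ts Us : remove1 Ts Us -> all_mult Ts -> all_mult Us.
Proof. by elim=> [T {}Ts []|T {}Ts {}Us _ IH /= [mT /IH]]. Qed.

(** An entry can be deleted in finitely many ways, so this is a finite union of thin sets. *)
Lemma thin_remove1 Ts (P : seq (E -> E) -> set E) :
  (forall Us, remove1 Ts Us -> thin (P Us)) ->
  thin [set F | exists2 Us, remove1 Ts Us & P Us F].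
Proof.
elim: Ts P => [|T Ts IH] P hP.
  exists (fun=> 1); first exact: polyfun_cst.
  split; first by exists 0; rewrite oner_eq0.
  by move=> F [Us h]; inversion h.
apply: thin_sub (thin_setU (hP Ts (remove1_head T Ts))
  (IH (fun Us => P (T :: Us)) _)) => [F [Us h PF]|Us h].
  by inversion h; subst; [left|right; exists Us0].
by apply: hP; constructor.
Qed.

(** If every exponent is positive, one factor of each operator is absorbed into f; a zero exponent
    makes its operator disappear. *)
Lemma orbit_split Ts f F : all_mult Ts -> orbit_of Ts f F ->
  orbit_of Ts (comps Ts f) F \/ exists2 Us, remove1 Ts Us & orbit_of Us f F.
Proof.
elim: Ts F => [|T Ts IH] F; first by left.
move=> /= [mT mTs] h; inversion h; subst.
case: k h => [|k] h; first by right; exists Ts => //; constructor.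
have [h1|[Us h1 h2]] := IH _ mTs H3; last first.
  by right; exists (T :: Us); constructor.
by left; rewrite iterSr; constructor; exact: orbit_mult.
Qed.

Theorem thin_orbit Ts f : all_mult Ts -> thin (orbit_of Ts f).
Proof.
have [n] := ubnP (size Ts); elim: n Ts => // n IH Ts; rewrite ltnS => sTs mTs.
have mP := mult_comps mTs.
(* In the model, the first case says that P f vanishes almost everywhere on [0, 1 - s]. *)
have [[s /andP[s01 /eqP Ps]]|nS] :=
  pselect (exists s, (0 < s < 1) && (S s (comps Ts f) == 0)); last first.
  apply: thin_sub (@thin_log_derivative _ (fun i : 'I_(size (log_coefs Ts f)) =>
    nth 0 (log_coefs Ts f) i) (comps Ts f) (comps Ts (D f)) _) => [F hF|s s01].
    have [c Ec] := log_derivative mTs hF; exists (fun i => c i).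
    by rewrite -Ec (bopB mP.1) !(multBr _ _ mP).
  by apply/negP => h; apply: nS; exists s; rewrite s01.
apply: (@thin_sub _ _ _ ([set F | S s F = 0] `|`
    [set F | exists2 Us, remove1 Ts Us & orbit_of Us f F])).
  move=> F /(orbit_split mTs)[h|]; [left|by right].
  (* [S s] is itself a multiplier, so it passes to the starting vector, which it kills. *)
  have {h} : orbit_of Ts (S s (comps Ts f)) (S s F).
    by apply: orbit_mult => //; apply: mult_shift; rewrite ltW//; case/andP: s01.
  rewrite Ps /=; move: (S s F) => {F}; elim: Ts mTs {sTs mP Ps} => [|T Ts IHT] mTs G h.
    by inversion h; subst; rewrite scaler0.
  case: mTs => mT mTs; inversion h; subst.
  by rewrite (IHT mTs _ H3) (bop0 (mult_iter k mT).1).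
apply: thin_setU; last first.
  apply: thin_remove1 => Us h; apply: IH; last exact: remove1_mult h mTs.
  by rewrite -(remove1_size h).
have [s_gt0 _] := andP s01; have bSs := bS (ltW s_gt0).
(* Composed with [S s], this functional vanishes on the kernel of [S s] but not at [e0]. *)
have [y hy] : exists y, sval (phi y) (S s e0) != 0.
  apply: contrapT => /forallNP h; move/negP: (Se0_neq0 s01); apply.
  by apply/eqP/phi_sep => y _; apply/eqP/negPn/negP; exact: h.
have [psi Epsi] := dual_comp (phi y) bSs.
exists (sval psi); first exact: polyfun_dual.
split; first by exists e0; rewrite Epsi.
by move=> F /= SF; rewrite Epsi SF linear0.
Qed.

End ShiftCommutant.

(** * Integrable functions and bounded operators on L1 *)

Section ScalarComplements.
Variables (R : realType) (k : base_field).
Local Notation K := (Defs.scalar R k).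
Local Notation "r %:K" := (mkscalar k r 0) (at level 1, left associativity, format "r %:K").

Lemma re_real (r : R) : re r%:K = r.
Proof. by rewrite /re /mkscalar; case: (k). Qed.

Lemma im_real (r : R) : im r%:K = 0.
Proof. by rewrite /im /mkscalar; case: (k). Qed.

Lemma scalar_ext (z z' : K) : re z = re z' -> im z = im z' -> z = z'.
Proof.
rewrite /re /im; case: (k) z z' => [z z' //|[a b] [c d] /= -> -> //].
Qed.

Lemma modulus_real (r : R) : modulus r%:K = `|r|.
Proof. by rewrite modulusE re_real im_real expr0n addr0 sqrtr_sqr. Qed.

Lemma real_scalar0 : 0%:K = 0 :> K.
Proof. by apply: scalar_ext; rewrite ?re_real ?im_real ?re0 ?im0. Qed.

Lemma real_scalar1 : 1%:K = 1 :> K.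
Proof.
have e : (1%:K : K) * 1%:K = 1%:K by rewrite -mkscalarM mulr1.
have n0 : 1%:K != 0 :> K.
  by apply/eqP => /mkscalar_eq0 /eqP; rewrite oner_eq0.
by apply: (mulfI n0); rewrite e mulr1.
Qed.

Lemma real_scalarD a b : (a + b)%:K = a%:K + b%:K :> K.
Proof. by rewrite -mkscalarD addr0. Qed.

Lemma real_scalarN a : (- a)%:K = - a%:K :> K.
Proof. by apply/eqP; rewrite eq_sym -subr_eq0 -opprD oppr_eq0 -real_scalarD subrr real_scalar0. Qed.

Lemma real_scalarB a b : (a - b)%:K = a%:K - b%:K :> K.
Proof. by rewrite real_scalarD real_scalarN. Qed.

Lemma real_scalar_ge0 (a : R) : (0 <= a%:K :> K) = (0 <= a).
Proof. by rewrite -real_scalar0 ler_mkscalar. Qed.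

Lemma real_scalar_gt0 (a : R) : (0 < a%:K :> K) = (0 < a).
Proof. by rewrite -real_scalar0 ltr_mkscalar. Qed.

Lemma gt0_scalar (z : K) : 0 < z -> exists2 r, 0 < r & z = r%:K.
Proof.
move=> z0; exists (modulus z); last by rewrite -normE gtr0_norm.
by rewrite -real_scalar_gt0 -normE normr_gt0 gt_eqF.
Qed.

Lemma modulusN (z : K) : modulus (- z) = modulus z.
Proof. by rewrite /modulus normrN. Qed.

Lemma ler_modulusB (x y z : K) : modulus (x - z) <= modulus (x - y) + modulus (y - z).
Proof. by rewrite (le_trans _ (ler_modulusD _ _))// addrA subrK. Qed.

Lemma reN (z : K) : re (- z) = - re z.
Proof. by apply/eqP; rewrite -subr_eq0 opprK -reD addNr re0. Qed.
Lemma imN (z : K) : im (- z) = - im z.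
Proof. by apply/eqP; rewrite -subr_eq0 opprK -imD addNr im0. Qed.

Lemma real_field_im (z : K) : k = RealField -> im z = 0.
Proof. by move: z; rewrite /im; case: (k). Qed.

Lemma im_mkscalar (a b : R) : (k = RealField -> b = 0) -> im (mkscalar k a b) = b.
Proof. by rewrite /im /mkscalar; case: (k) => // /(_ erefl). Qed.

Lemma re_mkscalar (a b : R) : re (mkscalar k a b) = a.
Proof. by rewrite /re /mkscalar; case: (k). Qed.

End ScalarComplements.
Notation "r %:K" := (mkscalar _ r 0) (at level 1, left associativity, format "r %:K").

(** * Classes of integrable functions and operators defined on representatives *)

Section Classes.
Variables (R : realType) (k : base_field).
Local Notation K := (Defs.scalar R k).
Local Notation lambda := (@lebesgue_measure R).
Local Notation I01 := (`[0, 1]%classic : set (measurableTypeR R)).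
Local Notation L1 := (L1 R k).
Implicit Types f g : R -> K.

Definition norm01 f : R := \int[lambda]_(t in I01) modulus (f t).

Lemma mI01 : measurable I01. Proof. exact: measurable_itv. Qed.
Hint Resolve mI01 : core.

Lemma integrable01_lin a f g : integrable01 f -> integrable01 g ->
  integrable01 (fun t => a * f t + g t).
Proof.
move=> /Lfun01P hf /Lfun01P hg; apply/Lfun01P.
exact: (@Lfun01_submod_closed R k).2.
Qed.

Lemma integrable01_0 : integrable01 (fun=> 0 : K).
Proof. apply/Lfun01P; exact: (@Lfun01_submod_closed R k).1. Qed.

Lemma integrable01Z a f : integrable01 f -> integrable01 (fun t => a * f t).
Proof.
move=> hf; have := integrable01_lin a hf integrable01_0.
by under eq_fun do rewrite addr0.
Qed.

Lemma integrable01D f g : integrable01 f -> integrable01 g ->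
  integrable01 (fun t => f t + g t).
Proof.
move=> hf hg; have := integrable01_lin 1 hf hg.
by under eq_fun do rewrite mul1r.
Qed.

Lemma integrable01B f g : integrable01 f -> integrable01 g ->
  integrable01 (fun t => f t - g t).
Proof.
move=> hf hg; have := integrable01_lin (-1) hg hf.
by under eq_fun do rewrite mulN1r addrC.
Qed.

Lemma eq_integrable01 f g : (forall t, 0 <= t <= 1 -> f t = g t) ->
  integrable01 f -> integrable01 g.
Proof.
move=> h [f1 f2]; split.
- by apply: eq_integrable f1 => // t; rewrite inE/= in_itv/= => /h ->.
- by apply: eq_integrable f2 => // t; rewrite inE/= in_itv/= => /h ->.
Qed.

Lemma norm01_ge0 f : 0 <= norm01 f.
Proof. by apply: Rintegral_ge0 => t _; exact: modulus_ge0. Qed.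

(** The default 0 makes the class map total, so that operators can be given by formulas on functions
    before integrability is known. *)
Definition mkL1 f : L1 :=
  if pselect (integrable01 f) is left h
  then L1class (MkL1fun ((Lfun01P f).2 h)) else 0.

Lemma mkL1E f (h : integrable01 f) : mkL1 f = L1class (MkL1fun ((Lfun01P f).2 h)).
Proof.
by rewrite /mkL1; case: pselect => // h'; rewrite (Prop_irrelevance h h').
Qed.

Lemma mkL1_lin a f g : integrable01 f -> integrable01 g ->
  mkL1 (fun t => a * f t + g t) = a *: mkL1 f + mkL1 g.
Proof.
move=> hf hg; have h := integrable01_lin a hf hg.
rewrite (mkL1E hf) (mkL1E hg) (mkL1E h).
rewrite [_ *: _]L1scale_class -L1classD; congr L1class; exact: val_inj.
Qed.

Lemma norm_mkL1 f : integrable01 f -> `|mkL1 f| = (norm01 f)%:K.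
Proof. by move=> hf; rewrite (mkL1E hf) [LHS]L1norm_class. Qed.

Lemma mkL1_eq f g : integrable01 f -> (forall t, 0 <= t <= 1 -> f t = g t) ->
  mkL1 f = mkL1 g.
Proof.
move=> hf h; have hg := eq_integrable01 h hf.
rewrite (mkL1E hf) (mkL1E hg); apply/L1classP/L1nullP.
apply: aeW => t; rewrite /= in_itv/= => t01.
by change (f t - g t = 0); rewrite h// subrr.
Qed.

Lemma mkL1_0 : mkL1 (fun=> 0) = 0.
Proof.
apply/normr0_eq0; rewrite (norm_mkL1 integrable01_0) /norm01.
by under eq_Rintegral do rewrite modulus0; rewrite Rintegral_cst// mul0r real_scalar0.
Qed.

Lemma mkL1B f g : integrable01 f -> integrable01 g ->
  mkL1 (fun t => f t - g t) = mkL1 f - mkL1 g.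
Proof.
move=> hf hg; rewrite -[in RHS](scaleN1r (mkL1 g)) addrC -mkL1_lin//.
by congr mkL1; apply/funext => t; rewrite mulN1r addrC.
Qed.

Lemma mkL1D f g : integrable01 f -> integrable01 g ->
  mkL1 (fun t => f t + g t) = mkL1 f + mkL1 g.
Proof.
move=> hf hg; rewrite -[in RHS](scale1r (mkL1 f)) -mkL1_lin//.
by congr mkL1; apply/funext => t; rewrite mul1r.
Qed.

Lemma mkL1Z a f : integrable01 f -> mkL1 (fun t => a * f t) = a *: mkL1 f.
Proof.
move=> hf; rewrite -[RHS]addr0 -mkL1_0 -mkL1_lin//; last exact: integrable01_0.
by congr mkL1; apply/funext => t; rewrite addr0.
Qed.

Lemma L1repr_integrable (u : L1) : integrable01 (L1repr u).
Proof. exact: L1fun_integrable. Qed.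

Lemma mkL1_repr (u : L1) : mkL1 (L1repr u) = u.
Proof.
rewrite (mkL1E (L1repr_integrable u)) -[RHS]L1reprK; congr L1class.
exact: val_inj.
Qed.

Lemma L1_ind (P : L1 -> Prop) :
  (forall f, integrable01 f -> P (mkL1 f)) -> forall u, P u.
Proof. by move=> h u; rewrite -(mkL1_repr u); apply: h; exact: L1repr_integrable. Qed.

Lemma mkL1_represents f u : represents f u -> integrable01 f -> u = mkL1 f.
Proof.
move=> fu hf; rewrite -(L1reprK u) (mkL1E hf); apply/L1classP/L1nullP.
move: fu; apply: filterS => t /[apply] h.
by change (L1repr u t - f t = 0); rewrite h subrr.
Qed.

Lemma represents_mkL1 f : integrable01 f -> represents f (mkL1 f).
Proof.
move=> hf; rewrite /represents (mkL1E hf).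
set F := MkL1fun _; have /L1nullP := L1repr_class F.
apply: filterS => t /[apply] h; apply/eqP; rewrite -subr_eq0; apply/eqP.
exact: h.
Qed.

(** The bound, applied to the difference of two representatives, shows that Phi depends only on the
    class; it then gives continuity. *)
Lemma bounded_lift (G : normedModType K) (Phi : (R -> K) -> G) (C : R) :
  (forall a f g, integrable01 f -> integrable01 g ->
    Phi (fun t => a * f t + g t) = a *: Phi f + Phi g) ->
  (forall f, integrable01 f -> `|Phi f| <= (C * norm01 f)%:K) ->
  exists T : {linear L1 -> G}, continuous T /\
    forall f, integrable01 f -> T (mkL1 f) = Phi f.
Proof.
move=> lin bnd; pose T0 (u : L1) := Phi (L1repr u).
have T0E f : integrable01 f -> T0 (mkL1 f) = Phi f.
  move=> hf; apply/eqP; rewrite -subr_eq0 -normr_le0.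
  set r := L1repr (mkL1 f); have hr : integrable01 r := L1repr_integrable _.
  have -> : T0 (mkL1 f) - Phi f = Phi (fun t => -1 * f t + r t).
    by rewrite lin// scaleN1r addrC.
  apply: le_trans (bnd _ (integrable01_lin _ hf hr)) _.
  rewrite mkscalarM -norm_mkL1; last exact: integrable01_lin.
  by rewrite mkL1_lin// mkL1_repr scaleN1r addNr normr0 mulr0.
have linT : linear T0.
  move=> a u v; elim/L1_ind: u => f hf; elim/L1_ind: v => g hg.
  by rewrite -mkL1_lin// !T0E//; [exact: lin|exact: integrable01_lin].
pose T : {linear L1 -> G} := HB.pack T0 (GRing.isLinear.Build K L1 G *:%R _ linT).
exists T; split; last exact: T0E.
apply: bounded_linear_continuous; apply/linear_boundedP.
exists (`|C|%:K); split.
  by rewrite realE real_scalar_ge0 normr_ge0.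
move=> r Cr u; elim/L1_ind: u => f hf.
rewrite [T _]T0E// (le_trans (bnd _ hf))// norm_mkL1//.
rewrite mkscalarM ler_wpM2r ?real_scalar_ge0 ?norm01_ge0//.
by rewrite (le_trans _ (ltW Cr))// ler_mkscalar ler_norm.
Qed.

(** Uses the chosen representative; independence of this choice comes from [bounded_op_lift]. *)
Definition op (A : (R -> K) -> R -> K) (u : L1) : L1 := mkL1 (A (L1repr u)).

Lemma bounded_op_lift (A : (R -> K) -> R -> K) (C : R) :
  (forall f, integrable01 f -> integrable01 (A f)) ->
  (forall a f g t, integrable01 f -> integrable01 g -> 0 <= t <= 1 ->
    A (fun t => a * f t + g t) t = a * A f t + A g t) ->
  (forall f, integrable01 f -> norm01 (A f) <= C * norm01 f) ->
  bounded_op (op A) /\ forall f, integrable01 f -> op A (mkL1 f) = mkL1 (A f).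
Proof.
move=> intA lin bnd.
have [a f g hf hg|f hf|T [cT TE]] := @bounded_lift L1 (mkL1 \o A) C.
- rewrite /= -mkL1_lin; [|exact: intA|exact: intA].
  apply: mkL1_eq; first by apply: intA; exact: integrable01_lin.
  by move=> t t01; exact: lin.
- by rewrite /= norm_mkL1 ?ler_mkscalar ?bnd//; exact: intA.
have -> : op A = T.
  by apply/funext; elim/L1_ind => f hf; rewrite /op -[LHS]TE ?mkL1_repr//; exact: L1repr_integrable.
by split => //; split => // a u v; rewrite linearP.
Qed.

End Classes.

(** * Translation invariance and the truncated shift of real functions *)

Section Shift.
Variable R : realType.
Local Notation lambda := (@lebesgue_measure R).
Local Notation TR := (measurableTypeR R).
Local Notation I01 := (`[0, 1]%classic : set TR).

Lemma lebesgue_measure_cc (a b : R) : a <= b ->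
  lambda (`[a, b]%classic : set TR) = (b - a)%:E.
Proof.
move=> ab; rewrite [LHS](lebesgue_measure_itv `[a, b])/= lte_fin.
by case: ltP => // ba; rewrite (le_anti (introT andP (conj ab ba))) subrr.
Qed.

Lemma integrable_cst_cc (a b c : R) :
  lambda.-integrable (`[a, b]%classic : set TR) (EFin \o (fun=> c)).
Proof.
apply: (@continuous_compact_integrable R (cst c)); first exact: segment_compact.
by apply: continuous_subspaceT => x; exact: cvg_cst.
Qed.

Lemma measurable_subr (s : R) : measurable_fun setT (fun x : TR => x - s : TR).
Proof. exact: measurable_funB. Qed.

(** The translated measure gives intervals their length, which characterizes Lebesgue measure. *)
Lemma lebesgue_measure_shift (s : R) (A : set TR) : measurable A ->
  pushforward lambda (fun x : TR => x - s : TR) A = lambda A.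
Proof.
move=> mA; pose f : {mfun TR >-> TR} :=
  HB.pack (fun x : TR => x - s : TR) (isMeasurableFun.Build _ _ _ _ _ (measurable_subr s)).
apply/esym; rewrite -[pushforward _ _]/(pushforward lambda f).
apply: lebesgue_measure_unique mA => //= _ [[a b]] _ <-.
rewrite /pushforward (_ : _ @^-1` _ = `]a + s, b + s]%classic); last first.
  by apply/seteqP; split => x /=; rewrite !in_itv/= ltrBrDr lerBlDr.
by rewrite /= !lebesgue_measure_itv/= !lte_fin ltrD2r -!EFinB opprD addrACA subrr addr0.
Qed.

Lemma ge0_integral_shift (s : R) (G : TR -> \bar R) :
  measurable_fun setT G -> (forall x, 0 <= G x)%E ->
  (\int[lambda]_x G (x - s)%R = \int[lambda]_x G x)%E.
Proof.
move=> mG G0.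
have := @ge0_integral_pushforward _ _ _ _ _ _ (measurable_subr s) lambda setT G
  measurableT mG (fun x _ => G0 x).
rewrite preimage_setT => <-; apply: eq_measure_integral; first exact: measurable_subr.
by move=> ? A mA _; exact: (lebesgue_measure_shift s mA).
Qed.

Definition real_shift (s : R) (g : R -> R) (x : R) := if s <= x then g (x - s) else 0.

(** On [0, 1] the truncated shift is an honest translate of the extension by zero, so invariance on
    the whole line applies. *)
Lemma real_shift_patch s (g : R -> R) x : x <= 1 -> 0 <= s ->
  real_shift s g x = (g \_ I01) (x - s).
Proof.
move=> x1 s0; rewrite /real_shift patchE; case: ifPn => sx.
  by rewrite mem_set//= in_itv/= subr_ge0 sx/= lerBlDr (le_trans x1)// lerDl.
by rewrite memNset//= in_itv/= subr_ge0 (negbTE sx).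
Qed.

Lemma integrable_real_shift s (g : R -> R) : 0 <= s ->
  lambda.-integrable I01 (EFin \o g) -> lambda.-integrable I01 (EFin \o real_shift s g).
Proof.
move=> s0 ig; have mI : measurable I01 by exact: measurable_itv.
have iG : lambda.-integrable setT (EFin \o (g \_ I01)).
  by rewrite -restrict_EFin; exact: ((integrable_mkcond _ mI).1 ig).
have iGs : lambda.-integrable setT (fun x => ((g \_ I01) (x - s))%:E).
  have /integrableP[mG fG] := iG; apply/integrableP; split.
    exact: (measurableT_comp mG (measurable_subr s)).
  rewrite (ge0_integral_shift s (G := fun x => `|((g \_ I01) x)%:E|%E))//.
  exact: measurableT_comp.
apply: (@eq_integrable _ _ _ _ _ mI (fun x => ((g \_ I01) (x - s))%:E)).
  by move=> x; rewrite inE/= in_itv/= => /andP[_ x1]; rewrite real_shift_patch.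
exact: integrableS iGs.
Qed.

Lemma Rintegral_real_shift_le s (g : R -> R) : 0 <= s -> (forall x, 0 <= g x) ->
  lambda.-integrable I01 (EFin \o g) ->
  \int[lambda]_(x in I01) real_shift s g x <= \int[lambda]_(x in I01) g x.
Proof.
move=> s0 g0 ig; have mI : measurable I01 by exact: measurable_itv.
have iG : lambda.-integrable setT (EFin \o (g \_ I01)).
  by rewrite -restrict_EFin; exact: ((integrable_mkcond _ mI).1 ig).
have mG : measurable_fun setT (EFin \o (g \_ I01)) by exact: measurable_int iG.
have G0 x : 0 <= (g \_ I01) x by rewrite patchE; case: ifP.
rewrite [leRHS]Rintegral_mkcond /Rintegral fine_le//.
- apply: integrable_fin_num => //; exact: integrable_real_shift.
- exact: integrable_fin_num.
rewrite -[leRHS](ge0_integral_shift s (G := fun x => ((g \_ I01) x)%:E))//.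
rewrite (eq_integral (fun x : TR => ((g \_ I01) (x - s))%:E)); last first.
  by move=> x; rewrite inE/= in_itv/= => /andP[_ x1]; rewrite real_shift_patch.
apply: ge0_subset_integral => //.
  exact: (measurableT_comp mG (measurable_subr s)).
by move=> x _; rewrite lee_fin.
Qed.

End Shift.

(** * Multiplication by bounded functions and the scalar-valued integral *)

Section Multiplication.
Variables (R : realType) (k : base_field).
Local Notation K := (Defs.scalar R k).
Local Notation lambda := (@lebesgue_measure R).
Local Notation TR := (measurableTypeR R).
Local Notation I01 := (`[0, 1]%classic : set TR).
Local Hint Resolve mI01 : core.
Implicit Types f g w : R -> K.

Definition measurable01 w :=
  measurable_fun I01 (fun t => re (w t)) /\ measurable_fun I01 (fun t => im (w t)).

Lemma le_norm01 f (G : R -> R) : integrable01 f ->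
  lambda.-integrable I01 (EFin \o G) ->
  (forall t, 0 <= t <= 1 -> modulus (f t) <= G t) ->
  norm01 f <= \int[lambda]_(t in I01) G t.
Proof.
move=> hf hG fG; apply: le_Rintegral => //; first exact: integrable_modulus.
Qed.

Lemma integrable01_mul w f M : measurable01 w ->
  (forall t, 0 <= t <= 1 -> modulus (w t) <= M) -> integrable01 f ->
  integrable01 (fun t => w t * f t) /\
  norm01 (fun t => w t * f t) <= M * norm01 f.
Proof.
move=> [mr mi] wM hf; have iM := integrable_modulus hf.
have iMM : lambda.-integrable I01 (EFin \o (fun t => M * modulus (f t))).
  by have := integrableZl (@mI01 R) M iM.
have bnd t : I01 t -> modulus (w t * f t) <= M * modulus (f t).
  by rewrite /= in_itv/= => t01; rewrite modulusM ler_wpM2r ?modulus_ge0// wM.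
have [hr hi] := hf.
have mfr : measurable_fun I01 (fun t => re (f t)).
  by apply/measurable_EFinP; exact: measurable_int hr.
have mfi : measurable_fun I01 (fun t => im (f t)).
  by apply/measurable_EFinP; exact: measurable_int hi.
have iw : integrable01 (fun t => w t * f t).
  split; apply: (le_integrable (@mI01 R) _ _ iMM).
  - apply/measurable_EFinP; rewrite (_ : (fun t => _) =
        (fun t => re (w t) * re (f t) - im (w t) * im (f t))).
      by apply: measurable_funB; exact: measurable_funM.
    by apply/funext => t; rewrite reM.
  - move=> t /bnd h; rewrite lee_fin (le_trans (ler_re _))// (le_trans h)//.
    exact: ler_norm.
  - apply/measurable_EFinP; rewrite (_ : (fun t => _) =
        (fun t => re (w t) * im (f t) + im (w t) * re (f t))).
      by apply: measurable_funD; exact: measurable_funM.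
    by apply/funext => t; rewrite imM.
  - move=> t /bnd h; rewrite lee_fin (le_trans (ler_im _))// (le_trans h)//.
    exact: ler_norm.
split => //; apply: (le_trans (le_norm01 iw iMM _)); last by rewrite RintegralZl.
by move=> t t01; apply: bnd; rewrite /= in_itv.
Qed.

Lemma lipschitz_measurable01 w L :
  (forall s t, 0 <= s <= 1 -> 0 <= t <= 1 -> modulus (w s - w t) <= L * `|s - t|) ->
  measurable01 w.
Proof.
move=> lip.
have aux (p : K -> R) : (forall z z', `|p z - p z'| <= modulus (z - z')) ->
    measurable_fun I01 (fun t => p (w t)).
  move=> hp; apply: subspace_continuous_measurable_fun => //.
  apply/subspace_continuousP => x xI; apply/cvgrPdist_le => e e0.
  have d0 : 0 < e / (`|L| + 1) by rewrite divr_gt0// ltr_wpDl.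
  near=> t.
  have tI : I01 t by near: t; exact: filter.withinT.
  apply: le_trans (hp _ _) _; apply: le_trans (lip _ _ _ _) _.
  - by move: xI; rewrite /= in_itv.
  - by move: tI; rewrite /= in_itv.
  rewrite (@le_trans _ _ ((`|L| + 1) * `|x - t|))//.
    by rewrite ler_wpM2r// (le_trans (ler_norm L))// lerDl.
  rewrite -ler_pdivlMl ?ltr_wpDl// mulrC.
  near: t; apply: cvg_within; apply/nbhs_ballP.
  by exists (e / (`|L| + 1)) => //= t; rewrite /ball/= => /ltW.
split.
- apply: aux => z z'; rewrite -[X in `|X|](_ : re (z - z') = _); first exact: ler_re.
  by rewrite reD reN.
- apply: aux => z z'; rewrite -[X in `|X|](_ : im (z - z') = _); first exact: ler_im.
  by rewrite imD imN.
Unshelve. all: by end_near. Qed.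

Lemma integrable01_1 : integrable01 (fun=> 1 : K).
Proof. by split; exact: integrable_cst_cc. Qed.

Lemma norm01_1 : norm01 (fun=> 1 : K) = 1.
Proof.
rewrite /norm01 -real_scalar1 modulus_real normr1 Rintegral_cst// mul1r.
apply: etrans (congr1 fine (lebesgue_measure_cc ler01)) _.
by rewrite /= subr0.
Qed.

Lemma integrable01_bounded w M : measurable01 w ->
  (forall t, 0 <= t <= 1 -> modulus (w t) <= M) ->
  integrable01 w /\ norm01 w <= M.
Proof.
move=> mw wM.
have [h1 h2] := integrable01_mul mw wM integrable01_1.
have E : (fun t => w t * 1) = w by apply/funext => t; rewrite mulr1.
rewrite E in h1 h2; split => //; apply: (le_trans h2).
by rewrite norm01_1 mulr1.
Qed.

Definition Kint f : K :=
  mkscalar k (\int[lambda]_(t in I01) re (f t)) (\int[lambda]_(t in I01) im (f t)).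

Lemma im_Kint f : im (Kint f) = \int[lambda]_(t in I01) im (f t).
Proof.
apply: im_mkscalar => kR.
under eq_Rintegral do rewrite real_field_im//.
by rewrite Rintegral_cst// mul0r.
Qed.

Lemma Kint_lin a f g : integrable01 f -> integrable01 g ->
  Kint (fun t => a * f t + g t) = a * Kint f + Kint g.
Proof.
move=> [fr fi] [gr gi].
have rZ c (h : R -> R) : lambda.-integrable I01 (fun t => (h t)%:E) ->
    lambda.-integrable I01 (fun t => (c * h t)%:E).
  by move=> ih; exact: (integrableZl (@mI01 R) c ih).
apply: scalar_ext.
- rewrite reD reM !re_mkscalar im_Kint.
  rewrite -!RintegralZl// -RintegralB//; [|exact: rZ|exact: rZ].
  rewrite -RintegralD//; first by apply: eq_Rintegral => t _; rewrite reD reM.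
  by apply: (integrableB (@mI01 R) (rZ _ _ fr) (rZ _ _ fi)).
- rewrite imD imM !im_Kint !re_mkscalar.
  rewrite -!RintegralZl// -RintegralD//; [|exact: rZ|exact: rZ].
  rewrite -RintegralD//; first by apply: eq_Rintegral => t _; rewrite imD imM.
  by apply: (integrableD (@mI01 R) (rZ _ _ fi) (rZ _ _ fr)).
Qed.

Lemma KintB f g : integrable01 f -> integrable01 g ->
  Kint (fun t => f t - g t) = Kint f - Kint g.
Proof.
move=> hf hg; rewrite -[in RHS](mulN1r (Kint g)) addrC -Kint_lin//.
by congr Kint; apply/funext => t; rewrite mulN1r addrC.
Qed.

Lemma eq_Kint f g : (forall t, 0 <= t <= 1 -> f t = g t) -> Kint f = Kint g.
Proof.
by move=> h; congr mkscalar; apply: eq_Rintegral => t;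
  rewrite inE/= in_itv/= => /h ->.
Qed.

(** Real and imaginary parts are estimated separately, hence the factor 2; later uses need only some
    finite constant. *)
Lemma le_modulus_Kint f : integrable01 f -> modulus (Kint f) <= 2 * norm01 f.
Proof.
move=> hf; have [fr fi] := hf; rewrite (le_trans (modulus_le _))// mulr2n mulrDl mul1r.
rewrite re_mkscalar im_Kint lerD//.
- rewrite (le_trans (le_normr_Rintegral _ _))//; apply: le_Rintegral => //.
  + by have := integrable_abse fr.
  + exact: integrable_modulus.
  + by move=> t _; exact: ler_re.
- rewrite (le_trans (le_normr_Rintegral _ _))//; apply: le_Rintegral => //.
  + by have := integrable_abse fi.
  + exact: integrable_modulus.
  + by move=> t _; exact: ler_im.
Qed.

End Multiplication.

(** * Causal kernels *)

Section Kernels.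
Variables (R : realType) (k : base_field).
Local Notation K := (Defs.scalar R k).
Local Notation lambda := (@lebesgue_measure R).
Local Notation TR := (measurableTypeR R).
Local Notation I01 := (`[0, 1]%classic : set TR).
Local Hint Resolve mI01 : core.
Implicit Types f g w u : R -> K.

Definition shiftf (s : R) f (x : R) : K := if s <= x then f (x - s) else 0.

Lemma shiftf_bound s f : 0 <= s -> integrable01 f ->
  integrable01 (shiftf s f) /\ norm01 (shiftf s f) <= norm01 f.
Proof.
move=> s0 hf; have [fr fi] := hf.
have Er : (fun t => re (shiftf s f t)) = real_shift s (fun t => re (f t)).
  by apply/funext => t; rewrite /shiftf /real_shift; case: ifP; rewrite ?re0.
have Ei : (fun t => im (shiftf s f t)) = real_shift s (fun t => im (f t)).
  by apply/funext => t; rewrite /shiftf /real_shift; case: ifP; rewrite ?im0.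
have Em t : modulus (shiftf s f t) = real_shift s (fun t => modulus (f t)) t.
  by rewrite /shiftf /real_shift; case: ifP; rewrite ?modulus0.
split; first split.
- by have := integrable_real_shift s0 fr; rewrite -Er.
- by have := integrable_real_shift s0 fi; rewrite -Ei.
rewrite /norm01; under eq_Rintegral do rewrite Em.
apply: Rintegral_real_shift_le => //; last exact: integrable_modulus.
by move=> x; exact: modulus_ge0.
Qed.

Definition step (b x : R) : K := if b <= x then 1 else 0.

Lemma integrable01_step b : 0 <= b -> integrable01 (step b).
Proof.
by move=> b0; exact: (shiftf_bound b0 (integrable01_1 R k)).1.
Qed.

(** Vanishing for y <= 0 truncates the convolution: only s < x contributes to the integral of
    [w (x - s) * u s]. Negative arguments are included because x - s takes such values. *)
Definition causal w (L : R) := [/\ 0 <= L, forall y, y <= 0 -> w y = 0 &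
  forall x y, x <= 1 -> y <= 1 -> modulus (w x - w y) <= L * `|x - y|].

Lemma causal_bound w L y : causal w L -> y <= 1 -> modulus (w y) <= L.
Proof.
move=> [L0 w0 lip] y1; have [y0|y0] := leP y 0.
  by rewrite w0// modulus0.
have := lip y 0 y1 ler01; rewrite (w0 0)// !subr0 gtr0_norm// => /le_trans; apply.
by rewrite ler_piMr.
Qed.

Lemma causal_integrable w L : causal w L ->
  integrable01 w /\ norm01 w <= L.
Proof.
move=> cw; have [L0 w0 lip] := cw.
apply: integrable01_bounded => [|t /andP[_ t1]]; last exact: causal_bound cw t1.
by apply: (@lipschitz_measurable01 _ _ _ L) => s t /andP[_ s1] /andP[_ t1]; exact: lip.
Qed.

Lemma causal_mul w L u x : causal w L -> integrable01 u -> x <= 1 ->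
  integrable01 (fun s => w (x - s) * u s).
Proof.
move=> cw hu x1; have [L0 w0 lip] := cw.
have le1 s : 0 <= s -> x - s <= 1 by move=> s0; rewrite lerBlDr (le_trans x1)// lerDl.
apply: (@integrable01_mul _ _ (fun s => w (x - s)) u L _ _ hu).1 => [|t /andP[t0 _]]; last first.
  by apply: causal_bound cw _; exact: le1.
apply: (@lipschitz_measurable01 _ _ _ L) => s t /andP[s0 _] /andP[t0 _].
rewrite (le_trans (lip _ _ (le1 _ s0) (le1 _ t0)))// ler_wpM2l//.
by rewrite (_ : x - s - (x - t) = - (s - t)) ?normrN//; lra.
Qed.

Definition Kconv w u x : K := Kint (fun s => w (x - s) * u s).

(** Convolving a causal kernel with an integrable function gives a causal kernel again, which makes
    nested convolutions possible. *)
Lemma causal_Kconv w L u : causal w L -> integrable01 u ->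
  causal (Kconv w u) (2 * (L * norm01 u)).
Proof.
move=> cw hu; have [L0 w0 lip] := cw; split.
- by rewrite !mulr_ge0// norm01_ge0.
- move=> y y0; rewrite /Kconv (@eq_Kint _ _ _ (fun=> 0)); last first.
    by move=> s /andP[s0 _]; rewrite w0 ?mul0r// subr_le0 (le_trans y0).
  apply/eqP; rewrite -[_ == _]/(Kint (fun=> 0 : K) == 0).
  have := @Kint_lin R k 1 (fun=> 0) (fun=> 0) (integrable01_0 R k) (integrable01_0 R k).
  rewrite mulr0 addr0 mul1r => /eqP.
  by rewrite -[X in X == _]addr0 (inj_eq (addrI _)) eq_sym.
- move=> x y x1 y1; rewrite /Kconv -KintB; [|exact: causal_mul cw _ _..].
  have hi : integrable01 (fun s => w (x - s) * u s - w (y - s) * u s).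
    by apply: integrable01B; exact: causal_mul cw _ _.
  apply: le_trans (le_modulus_Kint hi) _.
  rewrite -mulrA ler_wpM2l//.
  have iM := integrable_modulus hu.
  have iMM : lambda.-integrable I01 (EFin \o (fun t => L * `|x - y| * modulus (u t))).
    by have := integrableZl (@mI01 R) (L * `|x - y|) iM.
  apply: (le_trans (le_norm01 hi iMM _)); last by rewrite RintegralZl// mulrAC.
  move=> t /andP[t0 _]; rewrite -mulrBl modulusM ler_wpM2r ?modulus_ge0//.
  have le1 z : z <= 1 -> z - t <= 1 by move=> z1; rewrite lerBlDr (le_trans z1)// lerDl.
  rewrite (le_trans (lip _ _ (le1 _ x1) (le1 _ y1)))//.
  by rewrite (_ : x - t - (y - t) = x - y)//; lra.
Qed.

Lemma Kconv_linr w L a u u' x : causal w L -> integrable01 u -> integrable01 u' ->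
  x <= 1 -> Kconv w (fun s => a * u s + u' s) x = a * Kconv w u x + Kconv w u' x.
Proof.
move=> cw hu hu' x1; rewrite /Kconv -Kint_lin; [|exact: causal_mul cw _ _..].
by congr Kint; apply/funext => s; rewrite mulrDr mulrCA.
Qed.

Lemma Kconv_linl w w' v L L' a u x : causal w L -> causal w' L' -> integrable01 u ->
  (forall y, y <= 1 -> v y = a * w y + w' y) ->
  x <= 1 -> Kconv v u x = a * Kconv w u x + Kconv w' u x.
Proof.
move=> cw cw' hu hv x1; rewrite /Kconv -Kint_lin;
  [|exact: causal_mul cw _ _|exact: causal_mul cw' _ _].
apply: eq_Kint => s /andP[s0 _]; rewrite hv ?mulrDl ?mulrA//.
by rewrite lerBlDr (le_trans x1)// lerDl.
Qed.

(** For n > 0, the n-fold primitive of the unit step at 0. *)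
Definition tpow (n : nat) (y : R) : R := (Num.max y 0) ^+ n / n`!%:R.

Lemma tpow_le0 n y : (0 < n)%N -> y <= 0 -> tpow n y = 0.
Proof.
move=> n0 y0; rewrite /tpow (max_idPr y0) expr0n; case: n n0 => //= n _.
by rewrite mul0r.
Qed.

Lemma tpow_ge0 n y : 0 <= y -> tpow n y = y ^+ n / n`!%:R.
Proof. by move=> y0; rewrite /tpow (max_idPl y0). Qed.

Lemma dist_max0 (x y : R) : `|Num.max x 0 - Num.max y 0| <= `|x - y|.
Proof.
by rewrite ler_norml; case: (leP x 0) => hx; case: (leP y 0) => hy;
  case: (ger0P (x - y)) => h; apply/andP; split; lra.
Qed.

Lemma causal_tpow1 : causal (fun y => (tpow 1 y)%:K) 1.
Proof.
split => // [y y0|x y _ _]; first by rewrite tpow_le0// real_scalar0.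
by rewrite -real_scalarB modulus_real mul1r /tpow !expr1 divr1 divr1 dist_max0.
Qed.

Lemma causal_tpow2 : causal (fun y => (tpow 2 y)%:K) 1.
Proof.
split => // [y y0|x y x1 y1]; first by rewrite tpow_le0// real_scalar0.
rewrite -real_scalarB modulus_real mul1r /tpow -mulrBl subr_sqr normrM normrM.
rewrite (le_trans _ (dist_max0 x y))// -mulrA ler_piMr//.
have hx : 0 <= Num.max x 0 <= 1 by rewrite le_max lexx orbT ge_max x1 ler01.
have hy : 0 <= Num.max y 0 <= 1 by rewrite le_max lexx orbT ge_max y1 ler01.
move: (Num.max x 0) (Num.max y 0) hx hy => a b /andP[a0 a1] /andP[b0 b1].
rewrite ger0_norm ?addr_ge0// ger0_norm ?invr_ge0// ler_pdivrMr//.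
by rewrite -[2`!]/2%N; lra.
Qed.

(** The integrand lives on [a, x], where the fundamental theorem of calculus applies; convolution
    with a step raises the degree by one. *)
Lemma integral_tpow n (x a : R) : 0 <= a -> x <= 1 ->
  \int[lambda]_(s in I01) (if a <= s then tpow n.+1 (x - s) else 0) = tpow n.+2 (x - a).
Proof.
move=> a0 x1; have [xa|ax] := leP x a.
  rewrite tpow_le0// ?subr_le0//.
  rewrite (@eq_Rintegral _ _ _ _ _ (fun=> 0)) ?Rintegral_cst ?mul0r// => s _.
  by case: ifP => // sa; rewrite tpow_le0// subr_le0 (le_trans xa).
pose F s : R := - ((x - s) ^+ n.+2 / n.+2`!%:R).
pose g s : R := (x - s) ^+ n.+1 / n.+1`!%:R.
have dF (s : R) : is_derive s 1 F (g s).
  have d1 : is_derive s 1 ((cst x - id) : R -> R) (- 1).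
    by apply: is_derive_eq; rewrite sub0r.
  have d2 := @is_deriveX R R (cst x - id) n.+2 s 1 _ d1.
  have d3 := @is_deriveZ R R R _ (- (n.+2`!%:R)^-1) s 1 _ d2.
  have EF : F = - (n.+2`!%:R)^-1 \*: ((cst x - id) ^+ n.+2 : R -> R).
    by apply/funext => t; rewrite /F !fctE /= /GRing.scale /= mulNr mulrC.
  rewrite EF; apply: (is_derive_eq d3).
  have f0 : n.+1`!%:R != 0 :> R by rewrite pnatr_eq0 -lt0n fact_gt0.
  rewrite /g !fctE /= factS natrM /GRing.scale /=.
  by field; rewrite f0 -natrD pnatr_eq0.
have cg : continuous g.
  move=> s; apply: cvgMr_tmp.
  apply: (@continuous_comp R R R (fun t => x - t) (@GRing.exp R ^~ n.+1)).
    by apply: cvgB; [exact: cvg_cst|exact: cvg_id].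
  exact: exprn_continuous.
have dF' s : derivable F s 1 by have [] := dF s.
have cF : continuous F.
  by move=> s; apply/differentiable_continuous/derivable1_diffP.
have LR : derivable_oo_LRcontinuous F a x.
  by split => //; [exact/cvg_at_right_filter/cF|exact/cvg_at_left_filter/cF].
have FTC := continuous_FTC2 ax (continuous_subspaceT cg) LR.
have {}FTC : \int[lambda]_(s in `[a, x]) g s = tpow n.+2 (x - a).
  rewrite /Rintegral FTC => [|s _]; last by rewrite derive1E; apply: derive_val.
  rewrite /= /F subrr expr0n /= mul0r oppr0 sub0r opprK tpow_ge0//.
  by rewrite subr_ge0 ltW.
rewrite -FTC Rintegral_mkcond [RHS]Rintegral_mkcond; congr (Rintegral _ _ _).
apply/funext => s; rewrite !patchE !mem_setE /= !in_itv /=.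
have [sa|sa] := leP a s; last by rewrite if_same.
have [sx|sx] := leP s x => /=.
  by rewrite (le_trans a0 sa) (le_trans sx x1) tpow_ge0// subr_ge0.
by rewrite tpow_le0 ?if_same// subr_le0 ltW.
Qed.

Lemma Kint_real (h : R -> R) : Kint (fun s => (h s)%:K) =
  (\int[lambda]_(s in I01) h s)%:K :> K.
Proof.
apply: scalar_ext; rewrite ?re_mkscalar ?im_Kint ?im_real ?re_real.
  by apply: eq_Rintegral => s _; rewrite re_real.
by under eq_Rintegral do rewrite im_real; rewrite Rintegral_cst// mul0r.
Qed.

Lemma Kconv_step n (x a : R) : 0 <= a -> x <= 1 ->
  Kconv (fun y => (tpow n.+1 y)%:K) (step a) x = (tpow n.+2 (x - a))%:K.
Proof.
move=> a0 x1; rewrite -integral_tpow// -Kint_real; apply: eq_Kint => s _.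
by rewrite /step; case: ifP; rewrite ?mulr1 ?mulr0 ?real_scalar0.
Qed.

End Kernels.

(** * The shift, multiplication and convolution operators *)

Section Operators.
Variables (R : realType) (k : base_field).
Local Notation K := (Defs.scalar R k).
Local Notation L1 := (L1 R k).
Implicit Types (f g w : R -> K) (s x y : R).
Local Notation p n := (fun y : R => (tpow n y)%:K : K).

Definition Sop s : L1 -> L1 := op (shiftf s).
Definition Dop : L1 -> L1 := op (fun f x => x%:K * f x).
(* [Bop u v] is the second primitive of the convolution u * v and [Jop u] the
   third primitive of u.  The extra primitives make every kernel Lipschitz, so
   that no convolution of merely integrable functions is needed; all identities
   can then be checked on the step functions [step b], on which the operators
   give truncated powers. *)
Definition Jop : L1 -> L1 := op (Kconv (p 2)).
Definition Bop (u v : L1) : L1 :=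
  mkL1 (Kconv (Kconv (p 1) (L1repr v)) (L1repr u)).
Definition e0 : L1 := mkL1 (fun=> 1).

Lemma Sop_lift s : 0 <= s -> bounded_op (Sop s) /\
  forall f, integrable01 f -> Sop s (mkL1 f) = mkL1 (shiftf s f).
Proof.
move=> s0; apply: (@bounded_op_lift _ _ _ 1).
- by move=> f hf; have [] := shiftf_bound s0 hf.
- by move=> a f g t _ _ _; rewrite /shiftf; case: ifP; rewrite ?mulr0 ?addr0.
- by move=> f hf; rewrite mul1r; have [] := shiftf_bound s0 hf.
Qed.

Lemma Dop_lift : bounded_op Dop /\
  forall f, integrable01 f -> Dop (mkL1 f) = mkL1 (fun x => x%:K * f x).
Proof.
have h f : integrable01 f -> integrable01 (fun x => x%:K * f x) /\
    norm01 (fun x => x%:K * f x) <= 1 * norm01 f.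
  move=> hf; apply: integrable01_mul => //.
    apply: (@lipschitz_measurable01 _ _ _ 1) => s t _ _.
    by rewrite -real_scalarB modulus_real mul1r.
  by move=> t /andP[t0 t1]; rewrite modulus_real ger0_norm.
apply: (@bounded_op_lift _ _ _ 1) => [f /h[]//|a f g t _ _ _|f /h[]//].
by rewrite mulrDr mulrCA.
Qed.

Lemma Kconv_lift w L : causal w L -> bounded_op (op (Kconv w)) /\
  forall f, integrable01 f -> op (Kconv w) (mkL1 f) = mkL1 (Kconv w f).
Proof.
move=> cw; apply: (@bounded_op_lift _ _ _ (2 * L)).
- by move=> f hf; have [] := causal_integrable (causal_Kconv cw hf).
- by move=> a f g t hf hg /andP[_ t1]; exact: (Kconv_linr _ cw).
- move=> f hf; rewrite -mulrA.
  by have [] := causal_integrable (causal_Kconv cw hf).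
Qed.

Lemma Jop_lift : bounded_op Jop /\
  forall f, integrable01 f -> Jop (mkL1 f) = mkL1 (Kconv (p 2) f).
Proof. exact: (Kconv_lift (causal_tpow2 R k)). Qed.

Lemma causal_W v : integrable01 v -> causal (Kconv (p 1) v) (2 * (1 * norm01 v)).
Proof. exact: (causal_Kconv (causal_tpow1 R k)). Qed.

Lemma Bop_liftr f : integrable01 f ->
  let A g := Kconv (Kconv (p 1) g) f in
  bounded_op (op A) /\ forall g, integrable01 g -> op A (mkL1 g) = mkL1 (A g).
Proof.
(* Each of the two nested integrals contributes a factor 2. *)
move=> hf A; apply: (@bounded_op_lift _ _ _ (4 * norm01 f)).
- by move=> g hg; have [] := causal_integrable (causal_Kconv (causal_W hg) hf).
- move=> a g h t hg hh /andP[_ t1].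
  apply: (Kconv_linl (causal_W hg) (causal_W hh)) => // y y1.
  exact: (Kconv_linr _ (causal_tpow1 R k)).
- move=> g hg; have [_] := causal_integrable (causal_Kconv (causal_W hg) hf).
  by move/le_trans; apply; lra.
Qed.

Lemma BopE f g : integrable01 f -> integrable01 g ->
  Bop (mkL1 f) (mkL1 g) = mkL1 (Kconv (Kconv (p 1) g) f).
Proof.
move=> hf hg; rewrite /Bop.
have hr := L1repr_integrable (mkL1 g).
have [_ h1] := Kconv_lift (causal_W hr).
have [_ h2] := Bop_liftr hf.
by apply: etrans (h1 f hf) _; exact: h2 g hg.
Qed.

Lemma bounded_Bopl v : bounded_op (Bop^~ v).
Proof. by have [] := Kconv_lift (causal_W (L1repr_integrable v)). Qed.

Lemma bounded_Bopr u : bounded_op (Bop u).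
Proof.
have [h _] := Bop_liftr (L1repr_integrable u).
by rewrite (_ : Bop u = op (fun g => Kconv (Kconv (p 1) g) (L1repr u))).
Qed.

Lemma Sop0 u : Sop 0 u = u.
Proof.
elim/L1_ind: u => f hf; have [_ ->//] := Sop_lift (lexx 0).
apply/esym/mkL1_eq => // t /andP[t0 _].
by rewrite /shiftf t0 subr0.
Qed.

Lemma shiftf_integrable s f : 0 <= s -> integrable01 f -> integrable01 (shiftf s f).
Proof. by move=> s0 hf; have [] := shiftf_bound s0 hf. Qed.

Lemma shiftfD s t f x : 0 <= s -> 0 <= t ->
  shiftf s (shiftf t f) x = shiftf (s + t) f x.
Proof.
move=> s0 t0; rewrite /shiftf.
have -> : x - s - t = x - (s + t) by lra.
have [h|h] := leP (s + t) x.
  by rewrite ifT ?ifT//; lra.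
case: ifP => // sx; rewrite ifF//; apply/negbTE; rewrite -ltNge; lra.
Qed.

Lemma SopC s t u : 0 <= s -> 0 <= t -> Sop s (Sop t u) = Sop t (Sop s u).
Proof.
move=> s0 t0; elim/L1_ind: u => f hf.
have [_ Ss] := Sop_lift s0; have [_ St] := Sop_lift t0.
rewrite St// Ss; last exact: shiftf_integrable.
rewrite Ss// St; last exact: shiftf_integrable.
by congr mkL1; apply/funext => x; rewrite !shiftfD// addrC.
Qed.

Lemma Sop_e0 s : 0 <= s -> Sop s e0 = mkL1 (step k s).
Proof. by move=> s0; have [_ ->//] := Sop_lift s0; exact: integrable01_1. Qed.

Lemma DopS s u : 0 <= s -> Dop (Sop s u) = Sop s (Dop u) + s%:K *: Sop s u.
Proof.
move=> s0; elim/L1_ind: u => f hf.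
have [_ Ss] := Sop_lift s0; have [_ DE] := Dop_lift.
have hs := shiftf_integrable s0 hf.
have hD : integrable01 (fun x => x%:K * f x).
  apply: (@integrable01_mul _ _ _ f 1 _ _ hf).1.
    apply: (@lipschitz_measurable01 _ _ _ 1) => a b _ _.
    by rewrite -real_scalarB modulus_real mul1r.
  by move=> t /andP[t0 t1]; rewrite modulus_real ger0_norm.
rewrite Ss// DE// DE// Ss// addrC -mkL1_lin//; last exact: shiftf_integrable.
congr mkL1; apply/funext => x; rewrite /shiftf; case: ifP => _.
  by rewrite -mulrDl -real_scalarD subrKC.
by rewrite !mulr0 addr0.
Qed.

Lemma shiftf_tpow n (a b x : R) : 0 <= a -> 0 <= b ->
  shiftf a (fun x => (tpow n.+1 (x - b))%:K) x = (tpow n.+1 (x - (a + b)))%:K :> K.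
Proof.
move=> a0 b0; rewrite /shiftf; case: leP => h.
  by rewrite (_ : x - a - b = x - (a + b))//; lra.
by rewrite tpow_le0 ?real_scalar0//; lra.
Qed.

Lemma Jop_e s : 0 <= s -> Jop (Sop s e0) = mkL1 (fun x => (tpow 3 (x - s))%:K).
Proof.
move=> s0; rewrite Sop_e0//; have [_ ->] := Jop_lift; last exact: integrable01_step.
apply: mkL1_eq.
  by have [] := causal_integrable (causal_Kconv (causal_tpow2 R k) (integrable01_step k s0)).
by move=> x /andP[_ x1]; rewrite Kconv_step.
Qed.

Lemma integrable_tpow3 s : 0 <= s -> integrable01 (fun x => (tpow 3 (x - s))%:K : K).
Proof.
move=> s0; have hst := integrable01_step k s0.
apply: eq_integrable01 (causal_integrable (causal_Kconv (causal_tpow2 R k) hst)).1.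
by move=> x /andP[_ x1]; rewrite Kconv_step.
Qed.

Lemma Sop_tpow3 s t : 0 <= s -> 0 <= t ->
  Sop s (mkL1 (fun x => (tpow 3 (x - t))%:K)) = mkL1 (fun x => (tpow 3 (x - (s + t)))%:K).
Proof.
move=> s0 t0; have [_ ->] := Sop_lift s0; last exact: integrable_tpow3.
by congr mkL1; apply/funext => x; rewrite shiftf_tpow.
Qed.

Lemma Sop_Sop_e s t : 0 <= s -> 0 <= t -> Sop s (Sop t e0) = Sop (s + t) e0.
Proof.
move=> s0 t0; have [_ Ss] := Sop_lift s0; have [_ St] := Sop_lift t0.
have [_ Sst] := Sop_lift (addr_ge0 s0 t0); have i1 := integrable01_1 R k.
rewrite St// Ss; last exact: shiftf_integrable.
by rewrite Sst//; congr mkL1; apply/funext => x; rewrite shiftfD.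
Qed.

Lemma W_step s y : 0 <= s -> y <= 1 -> Kconv (p 1) (step k s) y = (tpow 2 (y - s))%:K :> K.
Proof. by move=> s0 y1; rewrite Kconv_step. Qed.

Lemma Bop_Se s u : 0 <= s -> Bop u (Sop s e0) = Sop s (Jop u).
Proof.
move=> s0; elim/L1_ind: u => f hf; rewrite Sop_e0//.
have hst := integrable01_step k s0.
rewrite BopE//; have [_ ->//] := Jop_lift.
have [_ ->] := Sop_lift s0; last first.
  by have [] := causal_integrable (causal_Kconv (causal_tpow2 R k) hf).
apply: mkL1_eq.
  by have [] := causal_integrable (causal_Kconv (causal_W hst) hf).
move=> x /andP[x0 x1]; rewrite /shiftf /Kconv.
have E : forall r, 0 <= r <= 1 -> Kconv (p 1) (step k s) (x - r) * f r =
    (tpow 2 (x - r - s))%:K * f r.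
  by move=> r /andP[r0 _]; rewrite W_step//; lra.
rewrite -/(Kconv _ _) (eq_Kint E); case: leP => h.
  by apply: eq_Kint => r _; rewrite (_ : x - r - s = x - s - r)//; lra.
have [_ h0 _] := causal_Kconv (causal_tpow2 R k) hf.
rewrite -(h0 (x - s)); last lra.
by apply: eq_Kint => r _; rewrite (_ : x - r - s = x - s - r)//; lra.
Qed.

Lemma Bop_ee s t : 0 <= s -> 0 <= t ->
  Bop (Sop s e0) (Sop t e0) = mkL1 (fun x => (tpow 3 (x - (s + t)))%:K).
Proof. by move=> s0 t0; rewrite Bop_Se// Jop_e// Sop_tpow3// addrC. Qed.

Lemma Jop_S_e s t : 0 <= s -> 0 <= t -> Jop (Sop s (Sop t e0)) = Sop s (Jop (Sop t e0)).
Proof.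
move=> s0 t0; rewrite Sop_Sop_e// !Jop_e ?addr_ge0//.
by rewrite Sop_tpow3.
Qed.

(** Evaluation at y of the third primitive, which is continuous and so has point values. The cap at
    1 keeps the point where causal kernels are controlled, whatever the real y. *)
Lemma phi_exists y : exists phi : dual L1,
  forall f, integrable01 f -> sval phi (mkL1 f) = Kconv (p 2) f (Num.min y 1).
Proof.
have y1 : Num.min y 1 <= 1 by rewrite ge_min lexx orbT.
have [a f g hf hg|f hf|T [cT TE]] :=
    @bounded_lift R k K^o (fun f => Kconv (p 2) f (Num.min y 1)) 2.
- exact: (Kconv_linr _ (causal_tpow2 R k)).
- rewrite normE ler_mkscalar -[norm01 f]mul1r.
  exact: (causal_bound (causal_Kconv (causal_tpow2 R k) hf)).
by exists (exist _ T cT).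
Qed.

Definition phi y : dual L1 := sval (cid (phi_exists y)).

Lemma phiE y f : integrable01 f -> sval (phi y) (mkL1 f) = Kconv (p 2) f (Num.min y 1).
Proof. by rewrite /phi; case: cid => phi0 /= h /h. Qed.

(** A primitive at y depends only on the function on [0, y], where the shifted one vanishes up to
    the endpoint. *)
Lemma phi_S y s u : 0 <= s -> y <= s -> sval (phi y) (Sop s u) = 0.
Proof.
move=> s0 ys; elim/L1_ind: u => f hf; have [_ ->//] := Sop_lift s0.
rewrite phiE; last exact: shiftf_integrable.
have [_ h0 _] := causal_Kconv (causal_tpow2 R k) (integrable01_1 R k).
rewrite -(h0 0)// /Kconv; apply: eq_Kint => r /andP[r0 _].
rewrite sub0r [tpow 2 (- r)]tpow_le0 ?oppr_le0// real_scalar0 mul0r /shiftf.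
case: leP => sr; last by rewrite mulr0.
rewrite tpow_le0 ?real_scalar0 ?mul0r//; rewrite subr_le0 (le_trans _ sr)//.
by rewrite ge_min ys.
Qed.

(** The third primitive of the step at s takes the nonzero value (1 - s)^3 / 6 at 1. *)
Lemma Sop_e0_neq0 s : 0 < s < 1 -> Sop s e0 != 0.
Proof.
move=> /andP[s0 s1]; apply/eqP => E; have := phiE 1 (integrable01_step k (ltW s0)).
have s0' := ltW s0.
rewrite -Sop_e0// E linear0 minxx Kconv_step// => /esym/mkscalar_eq0.
rewrite tpow_ge0 ?subr_ge0 1?ltW// => /eqP.
by rewrite mulf_eq0 invr_eq0 pnatr_eq0/= orbF expf_eq0/= subr_eq0 (gt_eqF s1).
Qed.

End Operators.

(** * Injectivity *)

Section RealInjectivity.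
Variable R : realType.
Local Notation lambda := (@lebesgue_measure R).
Local Notation TR := (measurableTypeR R).
Local Notation I01 := (`[0, 1]%classic : set TR).
Local Hint Resolve mI01 : core.
Variable r : R -> R.
Hypothesis ir : lambda.-integrable I01 (EFin \o r).

Lemma integrable_tpow1M (x : R) : lambda.-integrable I01 (EFin \o (fun s => tpow 1 (x - s) * r s)).
Proof.
have c : {within I01, continuous (fun s => tpow 1 (x - s))}.
  apply: continuous_subspaceT => s; apply/cvgrPdist_le => e e0.
  near=> t; rewrite /tpow !expr1 !divr1 (le_trans (dist_max0 _ _))//.
  rewrite (_ : x - s - (x - t) = - (s - t)); last lra.
  rewrite normrN; near: t; exact: (@cvgr_dist_le _ _ _ _ _ id).
have b : [bounded tpow 1 (x - s) | s in I01].
  exists (`|x| + 1); split; first exact: num_real.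
  move=> M hM s; rewrite /= in_itv/= => /andP[s0 s1].
  rewrite /tpow expr1 divr1 (le_trans _ (ltW hM))//.
  rewrite ger0_norm ?le_max ?lexx ?orbT// ge_max; apply/andP; split; last first.
    by rewrite addr_ge0.
  by rewrite lerD ?ler_norm//; lra.
have := integrableMr (@mI01 R) (subspace_continuous_measurable_fun (@mI01 R) c) b ir.
by [].
Unshelve. all: by end_near. Qed.

(** The difference quotient in x of [tpow 1 (x - s)], with increment h, equals the indicator of
    [0, x] except on ]x, x + h], where it is at most 1. Hence the first primitive at x is bounded by
    the integral of |r| over ]x, x + h], which tends to 0. *)
Lemma primitive_eq0 :
  (forall x, 0 <= x < 1 -> \int[lambda]_(s in I01) (tpow 1 (x - s) * r s) = 0) ->
  forall x, 0 <= x < 1 -> \int[lambda]_(s in `[0, x]) r s = 0.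
Proof.
move=> h0 x /andP[x0 x1].
pose G y := \int[lambda]_(s in `[0, y]) `|r s|.
have iar : lambda.-integrable I01 (EFin \o (fun s => `|r s|)).
  by have := integrable_abse ir.
have ix : lambda.-integrable `[0, x] (EFin \o r).
  by apply: (integrableS (@mI01 R)) ir => //; apply: subset_itvl; rewrite bnd_simp ltW.
have cG : {within `[0, 1], continuous G} by exact: parameterized_integral_continuous.
have key h : 0 < h -> x + h < 1 -> `|\int[lambda]_(s in `[0, x]) r s| <= G (x + h) - G x.
  move=> h_gt0 xh1.
  have xh : x < x + h by rewrite ltrDl.
  have ixh : lambda.-integrable `[0, x + h] (EFin \o (fun s => `|r s|)).
    by apply: (integrableS (@mI01 R)) iar => //; apply: subset_itvl; rewrite bnd_simp ltW.
  rewrite /G Rintegral_itvB// ?bnd_simp ?(ltW xh)//.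
  have irD (D : set TR) f : measurable D -> D `<=` I01 ->
      lambda.-integrable I01 (EFin \o f) -> lambda.-integrable I01 (EFin \o (f \_ D)).
    move=> mD DI jf; rewrite -restrict_EFin; apply/integrable_restrict => //.
    by apply: integrableS jf => //; exact: measurableI.
  have sub1 : `[0, x] `<=` I01 by apply: subset_itvl; rewrite bnd_simp ltW.
  have sub2 : `]x, (x + h)] `<=` I01.
    by apply: subset_itv; rewrite bnd_simp// ltW.
  have i2 : lambda.-integrable I01 (EFin \o (fun s => h * (r \_ `[0, x]) s)).
    exact: (integrableZl (@mI01 R) h (irD _ _ _ sub1 ir)).
  have i3 : lambda.-integrable I01
      (EFin \o (fun s => tpow 1 (x + h - s) * r s - tpow 1 (x - s) * r s)).
    by have := integrableB (@mI01 R) (integrable_tpow1M (x + h)) (integrable_tpow1M x).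
  have E : h * \int[lambda]_(s in `[0, x]) r s =
      \int[lambda]_(s in I01) (h * (r \_ `[0, x]) s -
        (tpow 1 (x + h - s) * r s - tpow 1 (x - s) * r s)).
    rewrite RintegralB//.
    rewrite RintegralB//; [|exact: integrable_tpow1M..].
    rewrite !h0 ?x0 ?x1//; last by rewrite xh1 andbT addr_ge0// ltW.
    rewrite subrr subr0 RintegralZl//; last exact: irD.
    rewrite -Rintegral_mkcondr; congr (_ * Rintegral _ _ _).
    exact/esym/setIidPr.
  have bnd : `|h * \int[lambda]_(s in `[0, x]) r s| <=
      h * \int[lambda]_(s in `]x, (x + h)]) `|r s|.
    have i4 := integrableB (@mI01 R) i2 i3.
    have i5 := irD _ _ (measurable_itv `]x, (x + h)]) sub2 iar.
    rewrite E (le_trans (le_normr_Rintegral _ _))//.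
    have -> : \int[lambda]_(s in `]x, (x + h)]) `|r s| =
        \int[lambda]_(s in I01) ((fun s => `|r s|) \_ `]x, (x + h)]) s.
      by rewrite -Rintegral_mkcondr; congr (Rintegral _ _ _); exact/esym/setIidPr.
    rewrite -RintegralZl//.
    apply: le_Rintegral => //.
    - by have := integrable_abse i4.
    - by have := integrableZl (@mI01 R) h i5.
    move=> s; rewrite /= in_itv/= => /andP[s0 s1]; rewrite !patchE !mem_setE !in_itv /=.
    rewrite s0/=; case: (leP s x) => sx /=.
      rewrite mulr0 !tpow_ge0 ?expr1; [|lra..].
      by rewrite !divr1 (_ : _ - _ = 0) ?normr0//; ring.
    have -> : tpow 1 (x - s) = 0 by rewrite tpow_le0//; lra.
    rewrite mulr0 mul0r subr0 sub0r normrN normrM.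
    case: (leP s (x + h)) => sxh.
      rewrite ler_wpM2r// tpow_ge0 ?expr1 ?divr1; last lra.
      by rewrite ger0_norm; lra.
    rewrite tpow_le0//; last lra.
    by rewrite normr0 mul0r mulr0.
  by move: bnd; rewrite normrM gtr0_norm// ler_pM2l.
apply/eqP; rewrite -normr_le0; apply/ler_addgt0Pl => e e0; rewrite addr0.
have /subspace_continuousP/(_ x) := cG.
rewrite /= in_itv/= x0 ltW// => /(_ isT)/cvgrPdist_lt/(_ _ e0).
rewrite near_withinE => /nbhs_ballP[d /= d0 hd].
pose h := Num.min (d / 2) ((1 - x) / 2).
have h_gt0 : 0 < h by rewrite lt_min; apply/andP; split; lra.
have hd2 : h <= d / 2 by rewrite ge_min lexx.
have hx2 : h <= (1 - x) / 2 by rewrite ge_min lexx orbT.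
have xh1 : x + h < 1 by lra.
apply: le_trans (key _ h_gt0 xh1) _.
have /= := hd (x + h); rewrite /ball /= opprD addrA subrr sub0r normrN gtr0_norm//.
move=> /(_ _ _)/ltW; rewrite distrC => /(_ _ _)/(le_trans (ler_norm _)); apply; first lra.
by rewrite in_itv/=; apply/andP; split; lra.
Qed.

(** Lebesgue differentiation: r is almost everywhere the derivative of its primitive. The endpoints
    are excluded so that small difference quotients stay inside [0, 1[. *)
Lemma ae_eq0_of_primitive :
  (forall x, 0 <= x < 1 -> \int[lambda]_(s in `[0, x]) r s = 0) ->
  ae_eq lambda I01 r (cst 0).
Proof.
move=> F0.
have ll := integrable_locally (@mI01 R) ir.
have iy (y : R) : lambda.-integrable [set` Interval (BLeft 0) (BRight y)] (EFin \o (r \_ I01)).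
  rewrite -restrict_EFin; apply/integrable_restrict => //.
  by apply: integrableS ir => //; exact: measurableI.
have := FTC1 iy ll.
have ne (a : R) : {ae lambda, forall x, x <> a}.
  exists [set a]; split => //; first exact: lebesgue_measure_set1.
  by move=> x /= /contrapT.
have AE := ae_filter_ringOfSetsType lambda.
move: (ne 0) (ne 1); apply: filterS3 => x x0 x1 FTC; rewrite /= in_itv/= => /andP[h0 h1].
have {}x0 : 0 < x by rewrite lt_neqAle h0 andbT eq_sym; apply/eqP.
have {}x1 : x < 1 by rewrite lt_neqAle h1 andbT; apply/eqP.
have [|_] := FTC; first by rewrite lte_fin.
rewrite patchE mem_setE in_itv/= h0 h1 /= => <-.
have FE y : 0 <= y < 1 -> \int[lambda]_(t in `[0, y]) (r \_ I01) t = 0.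
  move=> /andP[y0 y1]; rewrite -Rintegral_mkcondr -[RHS](F0 y) ?y0//.
  congr (Rintegral _ _ _); apply/setIidPl.
  by apply: subset_itvl; rewrite bnd_simp ltW.
rewrite /derive1; apply: cvg_lim => //.
apply: (@cvg_trans _ ((fun=> 0) @ (0 : R)^')); last exact: cvg_cst.
apply: near_eq_cvg; near=> h.
rewrite !FE ?subrr ?scaler0 ?h0//.
have : `|h| < Num.min x (1 - x).
  near: h; apply: dnbhs0_lt; rewrite lt_min x0 subr_gt0//.
rewrite lt_min ltr_norml => /andP[/andP[? ?]].
by rewrite ltr_norml => /andP[? ?]; apply/andP; split; lra.
Unshelve. all: by end_near. Qed.

End RealInjectivity.

Section Injectivity.
Variables (R : realType) (k : base_field).
Local Notation K := (Defs.scalar R k).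
Local Notation L1 := (L1 R k).
Local Notation lambda := (@lebesgue_measure R).
Local Notation TR := (measurableTypeR R).
Local Notation I01 := (`[0, 1]%classic : set TR).
Local Hint Resolve mI01 : core.
Implicit Types (f g w : R -> K) (s x y : R).
Local Notation p n := (fun y : R => (tpow n y)%:K : K).

(** A Taylor estimate that is uniform across the kink at 0. *)
Lemma tpow2_diff y h : 0 <= h -> `|tpow 2 (y + h) - tpow 2 y - h * tpow 1 y| <= h ^+ 2 / 2.
Proof.
move=> h0; have [y0|y0] := leP 0 y.
  rewrite !tpow_ge0 ?addr_ge0// -[2`!]/2%N -[1`!]/1%N ger0_norm.
    by rewrite (_ : _ - _ = h ^+ 2 / 2)//; field.
  rewrite (_ : _ - _ = h ^+ 2 / 2); last by field.
  by rewrite divr_ge0// sqr_ge0.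
rewrite [tpow 2 y]tpow_le0 ?[tpow 1 y]tpow_le0 ?(ltW y0)// subr0 mulr0 subr0.
have [yh|yh] := leP (y + h) 0; first by rewrite tpow_le0// normr0 divr_ge0// sqr_ge0.
rewrite tpow_ge0 ?(ltW yh)// -[2`!]/2%N ger0_norm; last by rewrite divr_ge0// sqr_ge0.
by rewrite ler_wpM2r// ler_sqr ?nnegrE ?(ltW yh)// gerDr ltW.
Qed.

(** Differentiation under the integral: by [tpow2_diff] the difference quotient, here zero, is
    within h times the norm of f of the lower-order convolution. *)
Lemma Kconv_tpow2_eq0 f : integrable01 f ->
  (forall x, 0 <= x < 1 -> Kconv (p 2) f x = 0) ->
  forall x, 0 <= x < 1 -> Kconv (p 1) f x = 0.
Proof.
move=> hf h0 x /andP[x0 x1]; apply: modulus0_eq0.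
have i1 z : z <= 1 -> integrable01 (fun s => (tpow 1 (z - s))%:K * f s).
  exact: (causal_mul (causal_tpow1 R k) hf).
have i2 z : z <= 1 -> integrable01 (fun s => (tpow 2 (z - s))%:K * f s).
  exact: (causal_mul (causal_tpow2 R k) hf).
have key h : 0 < h -> x + h < 1 ->
    modulus (Kconv (p 1) f x) <= h * norm01 f.
  move=> h_gt0 xh1.
  have j1 := i1 x (ltW x1); have j2 := i2 x (ltW x1); have j3 := i2 _ (ltW xh1).
  have j4 := integrable01B j3 j2; have j5 := integrable01_lin (- h%:K) j1 j4.
  have E : - h%:K * Kconv (p 1) f x = Kint (fun t => - h%:K *
      ((tpow 1 (x - t))%:K * f t) + ((tpow 2 (x + h - t))%:K * f t - (tpow 2 (x - t))%:K * f t)).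
    rewrite Kint_lin// KintB// -/(Kconv (p 2) f (x + h)) -/(Kconv (p 2) f x).
    by rewrite !h0 ?x0 ?x1 ?subrr ?addr0// xh1 andbT addr_ge0// ltW.
  have := le_modulus_Kint j5; rewrite -E modulusM modulusN modulus_real gtr0_norm// => le1.
  have iM := integrable_modulus hf.
  have iMM : lambda.-integrable I01 (EFin \o (fun t => h ^+ 2 / 2 * modulus (f t))).
    by have := integrableZl (@mI01 R) (h ^+ 2 / 2) iM.
  rewrite -(ler_pM2l h_gt0); apply: (le_trans le1).
  rewrite (_ : h * (h * norm01 f) = 2 * (h ^+ 2 / 2 * norm01 f)); last by field.
  rewrite ler_wpM2l// (le_trans (le_norm01 j5 iMM _))//; last by rewrite RintegralZl.
  move=> t _; rewrite [X in modulus X](_ : _ =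
      (tpow 2 (x - t + h) - tpow 2 (x - t) - h * tpow 1 (x - t))%:K * f t).
    by rewrite modulusM modulus_real ler_wpM2r ?modulus_ge0// tpow2_diff// ltW.
  rewrite !real_scalarB (mkscalarM k h) (_ : x - t + h = x + h - t); last by ring.
  by ring.
apply/eqP; rewrite eq_le modulus_ge0 andbT leNgt; apply/negP => c0.
set c := modulus _ in c0 key; have N0 := norm01_ge0 f; set N := norm01 f in N0 key.
(* This h contradicts c <= h N; N + 1 covers the case N = 0. *)
pose h := Num.min ((1 - x) / 2) (c / (2 * (N + 1))).
have h_gt0 : 0 < h.
  by rewrite lt_min !divr_gt0 ?subr_gt0 ?mulr_gt0// ltr_wpDl.
have hx : h <= (1 - x) / 2 by rewrite ge_min lexx.
have hc : h * (2 * (N + 1)) <= c.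
  by rewrite -ler_pdivlMr ?mulr_gt0 ?ltr_wpDl// ge_min lexx orbT.
have xh1 : x + h < 1 by lra.
have := key h h_gt0 xh1; nra.
Qed.

(** Undoes the three primitives one at a time; the last two steps treat the real and imaginary parts
    separately. *)
Lemma mkL1_eq0 f : integrable01 f ->
  (forall x, 0 <= x < 1 -> Kconv (p 2) f x = 0) -> mkL1 f = 0.
Proof.
move=> hf /(Kconv_tpow2_eq0 hf) h1.
have [fr fi] := hf.
have ae_re : ae_eq lambda I01 (fun t => re (f t)) (cst 0).
  apply: (ae_eq0_of_primitive fr); apply: (primitive_eq0 fr) => x x01.
  have := congr1 (@re R k) (h1 x x01); rewrite re_mkscalar re0 => E.
  rewrite -[RHS]E; apply: eq_Rintegral => t _.
  by rewrite reM re_real im_real mul0r subr0.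
have ae_im : ae_eq lambda I01 (fun t => im (f t)) (cst 0).
  apply: (ae_eq0_of_primitive fi); apply: (primitive_eq0 fi) => x x01.
  have := congr1 (@im R k) (h1 x x01); rewrite im_Kint im0 => E.
  rewrite -[RHS]E; apply: eq_Rintegral => t _.
  by rewrite imM re_real im_real mul0r addr0.
rewrite -(@mkL1_0 R k); apply: mkL1_represents; last exact: integrable01_0.
have AE := ae_filter_ringOfSetsType lambda.
move: ae_re ae_im (represents_mkL1 hf); apply: filterS3 => t hr hi h t01.
rewrite h//; apply: scalar_ext.
  by rewrite re0; exact: hr.
by rewrite im0; exact: hi.
Qed.

Lemma phi_sep (u : L1) : (forall y, 0 <= y < 1 -> sval (phi k y) u = 0) -> u = 0.
Proof.
elim/L1_ind: u => f hf h; apply: mkL1_eq0 => // x x01.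
rewrite -(h x x01) phiE//; congr (Kconv _ _ _).
by case/andP: x01 => _ /ltW /min_idPl.
Qed.

(** If w x has modulus c > 0, the Lipschitz bound keeps the modulus above c/2 on an interval to the
    right of x, so the norm is positive. *)
Lemma causal_norm_eq0 w L x : causal w L -> norm01 w = 0 -> 0 <= x < 1 -> w x = 0.
Proof.
move=> cw Nw /andP[x0 x1]; have [L0 w0 lip] := cw; have [iw _] := causal_integrable cw.
apply: modulus0_eq0; apply/eqP; rewrite eq_le modulus_ge0 andbT leNgt; apply/negP.
set c := modulus _ => c0.
pose d := Num.min (1 - x) (c / (2 * (L + 1))).
have d_gt0 : 0 < d by rewrite lt_min subr_gt0 x1 !divr_gt0 ?mulr_gt0// ltr_wpDl.
have dx : d <= 1 - x by rewrite ge_min lexx.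
have dc : d * (2 * (L + 1)) <= c.
  by rewrite -ler_pdivlMr ?mulr_gt0 ?ltr_wpDl// ge_min lexx orbT.
have sub : `[x, x + d] `<=` I01 by apply: subset_itv; rewrite bnd_simp//; lra.
have iM := integrable_modulus iw.
have mD : measurable (`[x, x + d]%classic : set TR) by exact: measurable_itv.
have iMD : lambda.-integrable `[x, x + d] (EFin \o (fun t => modulus (w t))).
  exact: integrableS iM.
have ic := integrable_cst_cc x (x + d) (c / 2).
have : \int[lambda]_(t in `[x, x + d]) (c / 2) <= norm01 w.
  apply: (@le_trans _ _ (\int[lambda]_(t in `[x, x + d]) modulus (w t))).
    apply: le_Rintegral => // t; rewrite /= in_itv/= => /andP[xt td].
    have := lip x t (ltW x1) _; have -> : t <= 1 by lra.
    move=> /(_ isT) l; have := ler_modulusB (w x) (w t) 0; rewrite !subr0 -/c.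
    have : L * `|x - t| <= L * d.
      by rewrite ler_wpM2l// distrC ger0_norm; lra.
    nra.
  rewrite /norm01 /Rintegral fine_le//; [exact: integrable_fin_num..|].
  apply: ge0_subset_integral => //; first exact: measurable_int iM.
  by move=> t _; rewrite lee_fin modulus_ge0.
rewrite Rintegral_cst// Nw => cd.
have Ed : fine (lambda (`[x, x + d]%classic : set TR)) = d.
  by rewrite lebesgue_measure_cc ?lerDl ?(ltW d_gt0)//= addrC addKr.
have : c / 2 * d <= 0 by rewrite -[X in _ * X]Ed.
by rewrite leNgt mulr_gt0// divr_gt0.
Qed.

Lemma Jop_inj (u : L1) : Jop u = 0 -> u = 0.
Proof.
elim/L1_ind: u => f hf; have [_ ->//] := Jop_lift R k => h.
have cJ := causal_Kconv (causal_tpow2 R k) hf.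
have [iJ _] := causal_integrable cJ.
apply: mkL1_eq0 => // x; apply: causal_norm_eq0 cJ _.
have := norm_mkL1 iJ; rewrite h normr0 => /esym; exact: mkscalar_eq0.
Qed.

End Injectivity.

(** * Density of step functions *)

Section StepApproximation.
Variables (R : realType) (k : base_field).
Local Notation K := (Defs.scalar R k).
Local Notation L1 := (L1 R k).
Local Notation lambda := (@lebesgue_measure R).
Local Notation TR := (measurableTypeR R).
Local Notation I01 := (`[0, 1]%classic : set TR).
Local Hint Resolve mI01 : core.
Implicit Types (f g w : R -> K) (s x y : R).

(** Increments of [a], extended by 0 before index 0, so that partial sums telescope to [a]. *)
Definition jump (a : nat -> K) (i : nat) : K :=
  if i is j.+1 then a j.+1 - a j else a 0%N.

Lemma sum_jump a j n : \sum_(i < n.+1) (if (i <= j)%N then jump a i else 0) = a (minn j n).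
Proof.
elim: n => [|n IH]; first by rewrite big_ord1 minn0.
rewrite big_ord_recr /= IH; have [h|h] := boolP (n.+1 <= j)%N.
  by rewrite (minn_idPr (ltnW h)) (minn_idPr h) subrKC.
rewrite -ltnNge ltnS in h; rewrite addr0; congr a.
by rewrite (minn_idPl h) (minn_idPl (leqW h)).
Qed.

(** On [0, 1] this is g at the last node i/(n+1) not exceeding x, with nodes from 0 to 1 included.
    Writing it with jumps exhibits it as a combination of shifts of 1. *)
Definition step_sum g n x : K :=
  \sum_(i < n.+2) jump (fun j => g (j%:R / n.+1%:R)) i * step k (i%:R / n.+1%:R) x.

Lemma step_sumE g n x : 0 <= x <= 1 ->
  exists2 y, 0 <= y <= x & (x <= y + n.+1%:R^-1) /\ step_sum g n x = g y.
Proof.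
move=> /andP[x0 x1]; set N : R := n.+1%:R.
have N0 : 0 < N by rewrite ltr0n.
have /truncn_itv/andP[jx xj] : 0 <= N * x by rewrite mulr_ge0// ltW.
set j := Num.truncn (N * x) in jx xj.
exists (j%:R / N); first by rewrite divr_ge0// ?(ltW N0)//= ler_pdivrMr// mulrC.
split; first by rewrite -[X in _ + X]mul1r -mulrDl natr1 ler_pdivlMr// mulrC ltW.
have jn : (j <= n.+1)%N.
  by rewrite -(ler_nat R) (le_trans jx)// ler_piMr// ltW.
rewrite -[X in g (X%:R / _)](minn_idPl jn) -(sum_jump (fun j => g (j%:R / N))).
apply: eq_bigr => i _; rewrite /step ler_pdivrMr// [x * N]mulrC.
have -> : (i%:R <= N * x) = (i <= j)%N.
  apply/idP/idP => h; last by rewrite (le_trans _ jx)// ler_nat.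
  by rewrite -ltnS -(ltr_nat R) (le_lt_trans h).
by case: ifP => _; rewrite ?mulr1 ?mulr0.
Qed.

Lemma integrable_sum n (F : nat -> R -> K) : (forall i, integrable01 (F i)) ->
  integrable01 (fun x => \sum_(i < n) F i x) /\
  mkL1 (fun x => \sum_(i < n) F i x) = \sum_(i < n) mkL1 (F i).
Proof.
move=> hF; elim: n => [|n [IH1 IH2]].
  split; first by under eq_fun do rewrite big_ord0; exact: integrable01_0.
  by rewrite big_ord0; under eq_fun do rewrite big_ord0; rewrite mkL1_0.
split; first by under eq_fun do rewrite big_ord_recr; exact: integrable01D.
rewrite big_ord_recr /= -IH2 -mkL1D//; congr mkL1.
by apply/funext => x; rewrite big_ord_recr.
Qed.

Lemma step_sum_L1 g n : integrable01 (step_sum g n) /\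
  mkL1 (step_sum g n) = \sum_(i < n.+2)
    jump (fun j => g (j%:R / n.+1%:R)) i *: Sop (i%:R / n.+1%:R) (e0 R k).
Proof.
have hst (i : nat) : integrable01 (step k (i%:R / n.+1%:R : R)).
  by apply: integrable01_step; rewrite divr_ge0.
have [h1 h2] := @integrable_sum n.+2 (fun i x =>
  jump (fun j => g (j%:R / n.+1%:R)) i * step k (i%:R / n.+1%:R) x)
  (fun i => integrable01Z _ (hst i)).
split => //; rewrite /step_sum h2; apply: eq_bigr => i _.
by rewrite mkL1Z// Sop_e0// divr_ge0.
Qed.

Lemma norm01_le_cst f M : integrable01 f ->
  (forall t, 0 <= t <= 1 -> modulus (f t) <= M) -> norm01 f <= M.
Proof.
move=> hf fM.
apply: le_trans (le_norm01 hf (integrable_cst_cc 0 1 M) fM) _.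
rewrite Rintegral_cst//.
suff -> : M * fine (lambda I01) = M by [].
by rewrite lebesgue_measure_cc//= subr0 mulr1.
Qed.

Lemma closed_approx (Z : set L1) u : closed Z ->
  (forall e : R, 0 < e -> exists2 z, Z z & `|u - z| <= e%:K) -> Z u.
Proof.
move=> cZ h; apply: cZ => B /nbhs_ballP[e /= e_gt0 he].
have [r r0 Er] := gt0_scalar e_gt0.
have [z Zz zu] := h (r / 2) (divr_gt0 r0 (ltr0n _ 2)).
exists z; split => //; apply: he; rewrite -ball_normE /= (le_lt_trans zu)// Er.
by rewrite ltr_mkscalar ltr_pdivrMr// mulr2n mulrDr mulr1 ltrDl.
Qed.

Lemma uniform_continuity01 (h : R -> R) : continuous h -> forall e : R, 0 < e ->
  exists n, forall x y, 0 <= x <= 1 -> y <= x -> x <= y + n.+1%:R^-1 -> `|h x - h y| <= e.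
Proof.
move=> ch e e0.
have /compact_near_coveringP := @segment_compact R 0 1.
move=> /(_ _ \oo (fun n x => forall y, y <= x -> x <= y + n.+1%:R^-1 -> `|h x - h y| <= e) _) [].
  move=> x _; have /cvgrPdist_lt/(_ (e / 2)) := ch x.
  rewrite divr_gt0// => /(_ isT)/nbhs_ballP[d /= d0 hd].
  have d2 : 0 < d / 2 by rewrite divr_gt0.
  near=> z n => y yz zy.
  have zx : `|x - z| < d / 2.
    by near: z; apply/nbhs_ballP; exists (d / 2).
  have nd : n.+1%:R^-1 < d / 2 by near: n; exact: near_infty_natSinv_lt (PosNum d2).
  have h1 : `|h x - h z| < e / 2.
    by apply: hd; apply: (lt_trans zx); rewrite ltr_pdivrMr// ltr_pMr// ltr1n.
  have h2 : `|h x - h y| < e / 2.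
    apply: hd; rewrite /ball/= (_ : x - y = (x - z) + (z - y)); last by ring.
    rewrite (le_lt_trans (ler_normD _ _))// [X in _ + X]ger0_norm ?subr_ge0//.
    by rewrite [ltRHS](splitr d) ltrD// ltrBlDl (le_lt_trans zy)// ltrD2l.
  rewrite (_ : h z - h y = - (h x - h z) + (h x - h y)); last by ring.
  rewrite (le_trans (ler_normD _ _))// normrN [leRHS](splitr e).
  by rewrite lerD// ltW.
by move=> n _ hn; exists n => x y x01; apply: (hn n) => //=.
Unshelve. all: by end_near. Qed.

(** [mkscalar k 0 1] is the imaginary unit over the complex field and 0 over the real one, which
    makes the formula uniform in k. *)
Lemma scalar_decomp (z : K) : z = mkscalar k 0 1 * (im z)%:K + (re z)%:K.
Proof.
rewrite /mkscalar /re /im; case: k z => [z|[a b]] /=; first by rewrite mul0r add0r.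
by apply/eqP; rewrite eq_complex /=; apply/andP; split; apply/eqP; ring.
Qed.

Lemma integrable01_real (r : R -> R) : lambda.-integrable I01 (EFin \o r) ->
  integrable01 (fun t => (r t)%:K : K).
Proof.
move=> ir; split.
  by apply: eq_integrable ir => // t _ /=; rewrite re_real.
have := (integrable01_0 R k).2; apply: eq_integrable => // t _.
by rewrite im0 im_real.
Qed.

(** Step sums give real continuous functions by uniform continuity, these give real integrable
    functions by density, and real and imaginary parts give everything. *)
Lemma total_steps (Z : set L1) : closed Z ->
  (forall a u v, Z u -> Z v -> Z (a *: u + v)) ->
  (forall s, 0 <= s -> Z (Sop s (e0 R k))) -> forall u, Z u.
Proof.
move=> cZ lZ sZ.
have Z0 : Z 0.
  by have := lZ (-1) _ _ (sZ 0 (lexx 0)) (sZ 0 (lexx 0)); rewrite scaleN1r addNr.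
have Zsum n (c : nat -> K) (s : nat -> R) : (forall i, 0 <= s i) ->
    Z (\sum_(i < n) c i *: Sop (s i) (e0 R k)).
  move=> s0; elim: n => [|n IH]; first by rewrite big_ord0.
  by rewrite big_ord_recr /= addrC; apply: lZ => //; exact: sZ.
have Zcont (h : R -> R) : continuous h -> Z (mkL1 (fun x => (h x)%:K)).
  move=> ch; apply: closed_approx => // e e_gt0.
  have ih : integrable01 (fun x => (h x)%:K : K).
    apply: integrable01_real; apply: continuous_compact_integrable.
      exact: segment_compact.
    exact: continuous_subspaceT.
  have [n hn] := uniform_continuity01 ch e_gt0.
  have [h1 h2] := step_sum_L1 (fun x => (h x)%:K) n.
  exists (mkL1 (step_sum (fun x => (h x)%:K) n)).
    rewrite h2; apply: (@Zsum n.+2 (jump _) (fun i => i%:R / n.+1%:R)) => i.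
    by rewrite divr_ge0.
  have i3 := integrable01B ih h1.
  rewrite -mkL1B// norm_mkL1// ler_mkscalar; apply: norm01_le_cst => // t t01.
  have [y /andP[y0 yt] [ty ->]] := step_sumE (fun x => (h x)%:K) n t01.
  by rewrite -real_scalarB modulus_real hn.
have Zreal (r : R -> R) : lambda.-integrable I01 (EFin \o r) -> Z (mkL1 (fun x => (r x)%:K)).
  move=> ir; apply: closed_approx => // e e_gt0.
  have fI : (lambda I01 < +oo)%E by rewrite lebesgue_measure_cc// ltry.
  have [g_ [cg ig]] := approximation_continuous_integrable (@mI01 R) fI ir.
  move=> /fine_cvgP[_ /cvgrPdist_lt/(_ _ e_gt0)[n _ /(_ n (leqnn n))]].
  rewrite /= sub0r normrN => gn.
  have i1 := integrable01_real ir; have i2 := integrable01_real (ig n).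
  exists (mkL1 (fun x => (g_ n x)%:K)); first exact: Zcont.
  rewrite -mkL1B// norm_mkL1; last exact: integrable01B.
  rewrite ler_mkscalar (le_trans _ (ltW gn))// (le_trans _ (ler_norm _))//.
  rewrite /norm01 /Rintegral; rewrite (_ : (\int[lambda]_(t in I01) _)%E =
    (\int[lambda]_(t in I01) `|(r t - g_ n t)%:E|)%E)//.
  by apply: eq_integral => t _; rewrite -real_scalarB modulus_real.
elim/L1_ind => f hf; have [fr fi] := hf.
have i1 := integrable01_real fr; have i2 := integrable01_real fi.
have -> : f = fun t => mkscalar k 0 1 * (im (f t))%:K + (re (f t))%:K.
  by apply/funext => t; exact: scalar_decomp.
by rewrite mkL1_lin//; apply: lZ; exact: Zreal.
Qed.

End StepApproximation.

(** * Commutation of the triple primitive with all multipliers *)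

Section Multipliers.
Variables (R : realType) (k : base_field).
Local Notation K := (Defs.scalar R k).
Local Notation L1 := (L1 R k).
Local Notation lambda := (@lebesgue_measure R).
Local Notation TR := (measurableTypeR R).
Local Notation I01 := (`[0, 1]%classic : set TR).
Local Hint Resolve mI01 : core.
Implicit Types (f g w : R -> K) (s : R).
Local Notation e0 := (e0 R k).
Local Notation mult := (@multiplier R K L1 (@Sop R k)).

Lemma norm_Sop s (u : L1) : 0 <= s -> `|Sop s u| <= `|u|.
Proof.
move=> s0; elim/L1_ind: u => f hf; have [_ ->//] := @Sop_lift R k s s0.
have [h1 h2] := shiftf_bound s0 hf.
by rewrite !norm_mkL1// ler_mkscalar.
Qed.

Lemma Jop_Sop s (u : L1) : 0 <= s -> Jop (Sop s u) = Sop s (Jop u).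
Proof.
move=> s0; have [bJ _] := Jop_lift R k; have [bS _] := @Sop_lift R k s s0.
have b1 := bounded_op_comp bJ bS; have b2 := bounded_op_comp bS bJ.
apply: (total_steps (bounded_op_eq_closed b1 b2)) => [a x y /= + +|t t0 /=].
  by rewrite !(bS.1, bJ.1) => -> ->.
exact: Jop_S_e.
Qed.

Lemma Bop_eS s (v : L1) : 0 <= s -> Bop (Sop s e0) v = Sop s (Jop v).
Proof.
move=> s0; have [bJ _] := Jop_lift R k; have [bS _] := @Sop_lift R k s s0.
have b2 := bounded_op_comp bS bJ.
apply: (total_steps (bounded_op_eq_closed (bounded_Bopr (Sop s e0)) b2)) => [a x y /= + +|t t0 /=].
  by rewrite (bounded_Bopr (Sop s e0)).1 !(bS.1, bJ.1) => -> ->.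
by rewrite Bop_ee// Jop_e// Sop_tpow3.
Qed.

(* Since [Jop e0] is the increasing function t ^ 3 / 6, the operator [Jop] is
   the strong limit of linear combinations of shifts whose coefficients are
   nonnegative and have sum at most 1. *)
Definition Rsum n (u : L1) : L1 := \sum_(i < n.+2)
  jump (fun j => (tpow 3 (j%:R / n.+1%:R))%:K) i *: Sop (i%:R / n.+1%:R) u.

Let node_ge0 i n : 0 <= i%:R / n.+1%:R :> R. Proof. exact: divr_ge0. Qed.

Lemma tpow3_nondecreasing (x y : R) : x <= y -> tpow 3 x <= tpow 3 y.
Proof.
move=> xy; rewrite /tpow ler_wpM2r//.
have m0 (z : R) : 0 <= Num.max z 0 by rewrite le_max lexx orbT.
by rewrite lerXn2r ?nnegrE// ge_max m0 andbT le_max xy.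
Qed.

(** Shifts are contractions, and the nonnegative coefficients telescope to [tpow 3 1], that is 1/6.
    Uniformity in n is what extends convergence by density. *)
Lemma norm_Rsum n u : `|Rsum n u| <= `|u|.
Proof.
pose a j : K := (tpow 3 (j%:R / n.+1%:R))%:K.
have jump_ge0 i : 0 <= jump a i.
  case: i => [|i] /=; first by rewrite real_scalar_ge0 tpow_ge0 ?node_ge0// divr_ge0// exprn_ge0.
  by rewrite -real_scalarB real_scalar_ge0 subr_ge0 tpow3_nondecreasing// ler_wpM2r// ler_nat.
rewrite (le_trans (ler_norm_sum _ _ _))//.
apply: (@le_trans _ _ (\sum_(i < n.+2) jump a i * `|u|)).
  by apply: ler_sum => i _; rewrite normrZ ger0_norm// ler_wpM2l// norm_Sop.
rewrite -mulr_suml ler_piMl//.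
have -> : \sum_(i < n.+2) jump a i = a n.+1.
  rewrite -[in RHS](minnn n.+1) -sum_jump; apply: eq_bigr => i _.
  by rewrite -ltnS ltn_ord.
rewrite /a divff ?pnatr_eq0// -(real_scalar1 R k) ler_mkscalar tpow_ge0// expr1n mul1r.
by rewrite invf_le1 ?ler1n ?ltr0n.
Qed.

Lemma Rsum_mult T n u : mult T -> T (Rsum n u) = Rsum n (T u).
Proof.
move=> [bT ST]; rewrite /Rsum (bop_sum bT); apply: eq_bigr => i _.
by rewrite (bopZ bT) ST.
Qed.

Lemma mult_Sop s : 0 <= s -> mult (Sop s).
Proof.
by move=> s0; split; [have [] := @Sop_lift R k s s0|move=> t u t0; exact: SopC].
Qed.

(** [Rsum n e0] is the step sum of t^3/6, compared within one node spacing using the Lipschitz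
    constant 2 supplied by [causal_Kconv]. *)
Lemma Rsum_e0 n : `|Rsum n e0 - Jop e0| <= (2 / n.+1%:R)%:K.
Proof.
have [h1 h2] := step_sum_L1 (fun x => (tpow 3 x)%:K : K) n.
rewrite -[Rsum n e0]h2 -[X in Jop X]Sop0 Jop_e//.
have i3 := integrable_tpow3 k (lexx (0 : R)).
rewrite -mkL1B// norm_mkL1; last exact: integrable01B.
rewrite ler_mkscalar; apply: norm01_le_cst; first exact: integrable01B.
move=> t t01; have [y /andP[y0 yt] [ty ->]] := step_sumE (fun x => (tpow 3 x)%:K : K) n t01.
have t1 : t <= 1 by case/andP: t01.
have [_ _ lip] := causal_Kconv (causal_tpow2 R k) (integrable01_1 R k).
have E z : z <= 1 -> (tpow 3 z)%:K = Kconv (fun y => (tpow 2 y)%:K) (step k 0) z :> K.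
  by move=> z1; rewrite Kconv_step// subr0.
have st : Kconv (fun y => (tpow 2 y)%:K) (step k 0) =1 Kconv (fun y => (tpow 2 y)%:K) (fun=> 1 : K).
  by move=> z; apply: eq_Kint => r /andP[r0 _]; rewrite /step r0.
rewrite subr0 !E ?(le_trans yt)// !st (le_trans (lip _ _ _ _))//.
  exact: le_trans yt t1.
rewrite norm01_1 mul1r mulr1 ler_wpM2l// ler0_norm ?subr_le0//.
by rewrite opprB lerBlDl.
Qed.

(** The u for which this holds form a subspace, closed by a three-epsilon argument with [norm_Rsum],
    and containing the shifts of [e0] by [Rsum_e0]. *)
Lemma cvg_Rsum u : Rsum n u @[n --> \oo] --> Jop u.
Proof.
have [bJ _] := Jop_lift R k.
pose Z := [set u : L1 | Rsum n u @[n --> \oo] --> Jop u].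
have RsumB n x y : Rsum n (x - y) = Rsum n x - Rsum n y.
  rewrite /Rsum -sumrB; apply: eq_bigr => i _.
  by rewrite (bopB (mult_Sop (node_ge0 i n)).1) scalerBr.
apply: (@total_steps R k Z).
- move=> x cx; apply/cvgrPdist_le => e e_gt0.
  have e3 : 0 < e / 3%:R by rewrite divr_gt0.
  have nx : nbhs x [set z | `|x - z| <= e / 3%:R /\ `|Jop x - Jop z| <= e / 3%:R].
    apply: filterI.
      by have /(@cvgrPdist_le _ L1 _ _ _ id)/(_ _ e3) : id @ nbhs x --> x by exact: cvg_id.
    by have /cvgrPdist_le/(_ _ e3) := bJ.2 x.
  have [z [Zz [xz Jxz]]] := cx _ nx.
  have /cvgrPdist_le/(_ _ e3) := Zz; apply: filterS => n hn.
  rewrite (_ : Jop x - Rsum n x = (Jop x - Jop z) + (Jop z - Rsum n z) - Rsum n (x - z)).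
    rewrite (le_trans (ler_normB _ _))// (_ : e = e / 3%:R + e / 3%:R + e / 3%:R); last by field.
    rewrite lerD// ?(le_trans (norm_Rsum _ _))//.
    by rewrite (le_trans (ler_normD _ _))// lerD.
  by rewrite RsumB opprB !subrKA.
- move=> a x y Zx Zy; rewrite /Z /= bJ.1.
  rewrite (_ : (fun n => _) = (fun n => a *: Rsum n x + Rsum n y)).
    apply: cvgD => //; exact: cvgZl_tmp.
  apply/funext => n; rewrite /Rsum scaler_sumr -big_split; apply: eq_bigr => i _ /=.
  by rewrite (mult_Sop (node_ge0 i n)).1.1 scalerDr !scalerA [_ * a]mulrC.
move=> s s0; rewrite /Z /= Jop_Sop//.
apply/cvgrPdist_le => e /gt0_scalar[r r0 ->].
near=> n.
rewrite -(Rsum_mult _ _ (mult_Sop s0)) -(bopB (mult_Sop s0).1) (le_trans (norm_Sop _ s0))//.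
rewrite distrC (le_trans (Rsum_e0 n))// ler_mkscalar.
rewrite -ler_pdivlMl// mulrC.
near: n; apply: filterS (near_infty_natSinv_lt (PosNum (divr_gt0 r0 (ltr0n R 2)))) => n /= /ltW.
by [].
Unshelve. all: by end_near. Qed.

(** T commutes with the finite sums [Rsum n]; passing to the limit at [e0] and then using shifts and
    density gives the claim. *)
Lemma mult_Jop T u : mult T -> T (Jop u) = Jop (T u).
Proof.
move=> mT; have [bT ST] := mT; have [bJ _] := Jop_lift R k.
have TJ0 : T (Jop e0) = Jop (T e0).
  have h : Rsum n (T e0) @[n --> \oo] --> T (Jop e0).
    under eq_fun do rewrite -(Rsum_mult _ _ mT).
    by apply: continuous_cvg; [exact: bT.2|exact: cvg_Rsum].
  exact: (cvg_unique (@norm_hausdorff K L1) h (@cvg_Rsum (T e0))).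
have b1 := bounded_op_comp bT bJ; have b2 := bounded_op_comp bJ bT.
apply: (total_steps (bounded_op_eq_closed b1 b2)) => [a x y /= + +|t t0 /=].
  by rewrite !(bT.1, bJ.1) => -> ->.
by rewrite Jop_Sop// !ST// Jop_Sop// TJ0.
Qed.

End Multipliers.

(** * Truncated convolution operators *)

Section TruncatedConvolutions.
Variables (R : realType) (k : base_field).
Local Notation K := (Defs.scalar R k).
Local Notation L1 := (L1 R k).
Local Notation lambda := (@lebesgue_measure R).
Local Notation TR := (measurableTypeR R).
Local Notation I01 := (`[0, 1]%classic : set TR).
Local Hint Resolve mI01 : core.
Implicit Types (f g w : R -> K) (s : R).
Local Notation e0 := (e0 R k).
Local Notation mult := (@multiplier R K L1 (@Sop R k)).

(** A continuous approximation of the step at b, vanishing at 0: the convolution formula is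
    prescribed on [C0], which contains no step function with b in [0, 1]. *)
Definition ramp (b : R) n (x : R) : R := Num.min (n.+1%:R * Num.max (x - b) 0) 1.

Lemma ramp_le0 b n x : x <= b -> ramp b n x = 0.
Proof.
by move=> xb; rewrite /ramp (max_idPr _) ?subr_le0// mulr0 (min_idPl ler01).
Qed.

Lemma ramp_continuous b n : continuous (ramp b n).
Proof.
move=> x.
apply: (@continuous_min R R (fun x => n.+1%:R * Num.max (x - b) 0) (cst 1) x); last exact: cvg_cst.
apply: cvgMl_tmp.
apply: (@continuous_max R R (fun x => x - b) (cst 0) x); last exact: cvg_cst.
by apply: cvgB; [exact: cvg_id|exact: cvg_cst].
Qed.

Lemma continuous_K (h : R -> R) : continuous h -> continuous (fun x => (h x)%:K : K).
Proof.
move=> ch x; apply/cvgrPdist_lt => e /gt0_scalar[r r0 ->].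
have /cvgrPdist_lt/(_ _ r0) := ch x; apply: filterS => t ht.
by rewrite -real_scalarB normE modulus_real ltr_mkscalar.
Qed.

Lemma ramp_C0 b n : 0 <= b -> C0 (fun x => (ramp b n x)%:K : K).
Proof.
move=> b0; split; last by rewrite ramp_le0// real_scalar0.
by apply: continuous_subspaceT; apply: continuous_K; exact: ramp_continuous.
Qed.

Lemma ramp_integrable b n : integrable01 (fun x => (ramp b n x)%:K : K).
Proof.
apply: integrable01_real; apply: continuous_compact_integrable.
  exact: segment_compact.
by apply: continuous_subspaceT; exact: ramp_continuous.
Qed.

Lemma shiftf_ramp s b n x : 0 <= s -> 0 <= b ->
  shiftf s (fun x => (ramp b n x)%:K) x = (ramp (b + s) n x)%:K :> K.
Proof.
move=> s0 b0; rewrite /shiftf; case: leP => sx.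
  by rewrite /ramp (_ : x - s - b = x - (b + s))//; ring.
by rewrite ramp_le0 ?real_scalar0//; lra.
Qed.

Lemma charge_integral0 (nu : {charge set TR -> \bar R}) (D : set TR) (h : TR -> R) :
  (forall t, D t -> h t = 0) -> charge_integral nu D h = 0.
Proof.
move=> h0; rewrite /charge_integral.
have E (mu : {measure set TR -> \bar R}) : \int[mu]_(t in D) h t = 0.
  rewrite (@eq_Rintegral _ _ _ _ _ (fun=> 0)); last by move=> t /set_mem/h0.
  by rewrite /Rintegral integral0.
by rewrite !E subrr.
Qed.

Lemma kintegral0 (m : kmeasure R k) f :
  (forall t, 0 <= t -> f t = 0) -> kintegral m f = 0.
Proof.
move=> f0; rewrite /kintegral /=.
rewrite !charge_integral0 ?subr0 ?addr0 ?real_scalar0// => t; rewrite /= in_itv/= => /andP[t0 _];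
  by rewrite f0// ?re0 ?im0.
Qed.

(** For s <= x the two integrands are the same function of t; for x < s the integrand on the left
    vanishes for all t >= 0. *)
Lemma conv_shiftf (m : kmeasure R k) s f x : 0 <= s ->
  Defs.conv m (shiftf s f) x = shiftf s (Defs.conv m f) x.
Proof.
move=> s0; rewrite /Defs.conv {2}/shiftf; case: leP => sx.
  congr kintegral; apply/funext => t; rewrite /shifted /shiftf.
  rewrite (_ : x - t - s = x - s - t); last by ring.
  rewrite lerBrDr lerBrDr addrC; case: (leP t x) => //= tx.
  by rewrite ifF//; apply/negbTE; rewrite -ltNge; lra.
apply: kintegral0 => t t0; rewrite /shifted /shiftf.
case: ifP => // tx; rewrite ifF//; apply/negbTE; rewrite -ltNge; lra.
Qed.

Lemma ae_shift s (P : R -> Prop) : {ae lambda, forall x, P x} ->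
  {ae lambda, forall x, P (x - s)}.
Proof.
move=> [N [mN N0 PN]].
exists ((fun x : TR => x - s : TR) @^-1` N); split.
- by rewrite -[X in measurable X]setTI; apply: (measurable_subr s).
- by apply: etrans (lebesgue_measure_shift s mN) N0.
- by move=> x hx; apply: PN.
Qed.

Lemma represents_Sop s f (u : L1) : 0 <= s -> represents f u ->
  represents (shiftf s f) (Sop s u).
Proof.
move=> s0 fu; have ir := L1repr_integrable u.
rewrite -[in Sop s u](mkL1_repr u); have [_ ->//] := @Sop_lift R k s s0.
have h := represents_mkL1 (shiftf_integrable s0 ir).
have h' := @ae_shift s _ fu.
have AE := ae_filter_ringOfSetsType lambda.
move: h h'; apply: filterS2 => x h h' x01; rewrite h// /shiftf.
case: ifP => // sx; apply: h'; move: x01; rewrite /= !in_itv/= => /andP[x0 x1].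
by rewrite subr_ge0 sx/= lerBlDr (le_trans x1)// lerDl.
Qed.

Lemma represents_inj f (u v : L1) : represents f u -> represents f v -> u = v.
Proof.
move=> fu fv; rewrite -(mkL1_repr v); apply: mkL1_represents; last exact: L1repr_integrable.
have AE := ae_filter_ringOfSetsType lambda.
by move: fu fv; apply: filterS2 => x h1 h2 x01; rewrite h1// h2.
Qed.

(** The two functions differ only on an interval of length 1/(n+1), and there by at most 1. *)
Lemma step_ramp b n : 0 <= b ->
  `|Sop b e0 - mkL1 (fun x => (ramp b n x)%:K)| <= (n.+1%:R^-1)%:K.
Proof.
move=> b0; rewrite Sop_e0//.
have i1 := integrable01_step k b0; have i2 := ramp_integrable b n.
rewrite -mkL1B// norm_mkL1; last exact: integrable01B.
have N0 : 0 < n.+1%:R :> R by rewrite ltr0n.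
rewrite ler_mkscalar; set N := n.+1%:R.
pose A : set TR := `[b, b + N^-1]%classic.
have mA : measurable A by exact: measurable_itv.
have iA : lambda.-integrable I01 (EFin \o ((cst 1 : TR -> R) \_ A)).
  rewrite -restrict_EFin; apply/integrable_restrict => //.
  by apply: integrableS (integrable_cst_cc 0 1 1) => //; exact: measurableI.
apply: le_trans (le_norm01 (integrable01B i1 i2) iA _) _.
  move=> t /andP[t0 t1]; rewrite patchE mem_setE in_itv/= /step.
  have [bt|tb] := leP b t => /=; last first.
    by rewrite ramp_le0 ?(ltW tb)// real_scalar0 subrr modulus0.
  rewrite -real_scalar1 -real_scalarB modulus_real /ramp (max_idPl _) ?subr_ge0//.
  case: (leP t (b + N^-1)) => tN.
    have : n.+1%:R * (t - b) <= 1.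
      by rewrite -ler_pdivlMl// mulr1 lerBlDl.
    have : 0 <= n.+1%:R * (t - b) by rewrite mulr_ge0 ?subr_ge0// ltW.
    by move=> h1 h2; rewrite (min_idPl h2) ger0_norm; lra.
  have h2 : 1 <= n.+1%:R * (t - b).
    by rewrite -ler_pdivrMl// mulr1 lerBrDl ltW.
  by rewrite (min_idPr h2) subrr normr0.
rewrite -Rintegral_mkcondr Rintegral_cst ?mul1r; last exact: measurableI.
have EA : lambda A = (N^-1)%:E.
  by rewrite lebesgue_measure_cc ?lerDl ?invr_ge0 ?ltW// addrC addKr.
have le : (lambda (I01 `&` A) <= lambda A)%E.
  by apply: le_measure; rewrite ?inE//; exact: measurableI.
rewrite -[leRHS]/(fine (N^-1)%:E) -EA fine_le// ?EA//.
by rewrite ge0_fin_numE// (le_lt_trans le)// EA ltry.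
Qed.

(** On ramps T is the explicit convolution, which commutes with shifts pointwise. Ramps approximate
    the shifts of [e0], so continuity and totality extend the commutation to all of L1. *)
Lemma truncated_convolution_mult (T : {linear L1 -> L1}) :
  truncated_convolutions T -> mult T.
Proof.
move=> [m [cT ext]].
have bT : bounded_op T by split => // a u v; rewrite linearP.
split=> // s u s0; have [bS _] := @Sop_lift R k s s0.
have b1 := bounded_op_comp bT bS; have b2 := bounded_op_comp bS bT.
have cZ := bounded_op_eq_closed b1 b2.
apply: (total_steps cZ) => [a x y /= + +|b b0]; first by rewrite !(bT.1, bS.1) => -> ->.
apply: (closed_approx cZ) => e e_gt0.
have [n ne] : exists n, n.+1%:R^-1 < e.
  by have [n _ /(_ n (leqnn n))] := near_infty_natSinv_lt (PosNum e_gt0); exists n.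
exists (mkL1 (fun x => (ramp b n x)%:K)); last first.
  by apply: le_trans (step_ramp n b0) _; rewrite ler_mkscalar ltW.
have ir := ramp_integrable b n.
have h1 : represents (Defs.conv m (fun x => (ramp b n x)%:K)) (T (mkL1 (fun x => (ramp b n x)%:K))).
  by apply: ext; [exact: ramp_C0|exact: represents_mkL1].
have E : Sop s (mkL1 (fun x => (ramp b n x)%:K)) = mkL1 (fun x => (ramp (b + s) n x)%:K) :> L1.
  have [_ ->//] := @Sop_lift R k s s0; congr mkL1; apply/funext => x; exact: shiftf_ramp.
rewrite /= E; apply: represents_inj (represents_Sop s0 h1).
have -> : shiftf s (Defs.conv m (fun x => (ramp b n x)%:K)) =
    Defs.conv m (fun x => (ramp (b + s) n x)%:K).
  apply/funext => x; rewrite -conv_shiftf//; congr (Defs.conv m _ x).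
  by apply/funext => z; exact: shiftf_ramp.
apply: ext; last by apply: represents_mkL1; exact: ramp_integrable.
by apply: ramp_C0; rewrite addr_ge0.
Qed.

Lemma orbit_of_projective n (T : 'I_n -> {linear L1 -> L1}) f (e : 'I_n -> nat) (w : K) (u : L1) :
  orbit_of [seq (T i : L1 -> L1) | i <- enum 'I_n] u
    (w *: (\big[(fun S S' => S \o S')/idfun]_(i < n) iter (e i) (T i)) u).
Proof.
elim: n T e => [|n IH] T e.
  by rewrite big_ord0 enum_ord0; constructor.
rewrite big_ord_recl enum_ordSl /= -map_comp.
(* The scalar stands outermost in the projective orbit and innermost in [orbit_of]; linearity moves
   it inward. *)
have iterZ j v : w *: iter j (T ord0) v = iter j (T ord0) (w *: v).
  by elim: j => //= j <-; rewrite linearZ.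
by rewrite iterZ; constructor; exact: (IH (fun i => T (lift ord0 i))).
Qed.

Lemma all_mult_map n (T : 'I_n -> {linear L1 -> L1}) :
  (forall i, truncated_convolutions (T i)) ->
  all_mult (@Sop R k) [seq (T i : L1 -> L1) | i <- enum 'I_n].
Proof.
by move=> h; elim: (enum 'I_n) => //= i l IH; split => //; exact: truncated_convolution_mult.
Qed.

Theorem thin_projective_orbit n (T : 'I_n -> {linear L1 -> L1}) (u : L1) :
  (forall i, truncated_convolutions (T i)) -> thin (projective_orbit T u).
Proof.
move=> hT.
apply: (@thin_sub _ _ _ (orbit_of [seq (T i : L1 -> L1) | i <- enum 'I_n] u)).
  by move=> _ [e [w ->]]; exact: orbit_of_projective.
have [bD _] := Dop_lift R k; have [bJ _] := Jop_lift R k.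
apply: (@thin_orbit R K L1 (@Sop R k) e0 (@Dop R k) (@Jop R k) (@Bop R k)
  (fun s => s%:K) (@phi R k)); last exact: all_mult_map.
- by move=> s s0; have [] := @Sop_lift R k s s0.
- by move=> s t v; exact: SopC.
- exact: Sop0.
- by move=> s; exact: Sop_e0_neq0.
- exact: total_steps.
- exact: bD.
- by move=> s s0; apply/eqP => /mkscalar_eq0 E; rewrite E ltxx in s0.
- by move=> s v; exact: DopS.
- by move=> s v; exact: Jop_Sop.
- exact: bJ.
- exact: Jop_inj.
- exact: bounded_Bopl.
- exact: bounded_Bopr.
- by move=> s v; exact: Bop_Se.
- by move=> s v; exact: Bop_eS.
- exact: phi_sep.
- by move=> y s v; exact: phi_S.
- by move=> S v; exact: mult_Jop.
Qed.

End TruncatedConvolutions.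

Theorem theorem1p1 (R : realType) (k : base_field) (n : nat) (hn : (0 < n)%N)
    (T : 'I_n -> {linear L1 R k -> L1 R k})
    (hT : forall i : 'I_n, truncated_convolutions (T i))
    (f : L1 R k) :
  nowhere_dense (projective_orbit T f : set (weak (L1 R k))).
Proof. exact/thin_nowhere_dense/thin_projective_orbit. Qed.
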